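(* Let $\Upsilon$ be a tree. The Banach space $C_0(\Upsilon)$ admits an equivalent norm with the Kadec property if and only if there exists an increasing function $\rho:\Upsilon\to\mathbb{R}$ with no bad points.
   Context: A tree is a partially ordered set $(\Upsilon,\preceq)$ such that for each $t\in\Upsilon$ the set $\{s: s\preceq t\}$ is well-ordered by $\preceq$. Write $(0,t]=\{s:s\preceq t\}$, $(0,t)=\{s:s\prec t\}$, and let $r(t)$ be the order type of $(0,t)$. All trees are assumed Hausdorff: if $r(t)$ is a limit ordinal and $(0,t)=(0,t')$ then $t=t'$. $\Upsilon$ carries the coarsest topology in which every $(0,t]$ is open and closed (a locally compact Hausdorff topology). $C_0(\Upsilon)$ is the Banach space of continuous $f:\Upsilon\to\mathbb{R}$ such that $\{t:|f(t)|\ge\epsilon\}$ is compact for every $\epsilon>0$, with the supremum norm. The set $t^+$ of immediate successors of $t$ consists of those $u$ with $(0,u)=(0,t]$. A function $\rho:\Upsilon\to\mathbb{R}$ is increasing if $s\preceq t$ implies $\rho(s)\le\rho(t)$. For increasing $\rho$, a point $t$ is good for $\rho$ if there is a finite $F\subseteq t^+$ with $\inf_{u\in t^+\setminus F}\rho(u)>\rho(t)$ (an infimum over the empty set is $+\infty$); otherwise $t$ is bad for $\rho$. A norm on a Banach space $X$ has the Kadec property if the weak topology and the norm topology coincide on its unit sphere $\{x:\|x\|=1\}$. *)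

(* Defs.v *)
From Stdlib Require Import Reals List.
Set Implicit Arguments.
Open Scope R_scope.

Section Tree.
Variables (T : Type) (le : T -> T -> Prop).

Definition tree_lt (s t : T) : Prop := le s t /\ s <> t.

Definition is_tree : Prop :=
  (forall t, le t t) /\
  (forall s t, le s t -> le t s -> s = t) /\
  (forall r s t, le r s -> le s t -> le r t) /\
  (forall t, forall a b, le a t -> le b t -> le a b \/ le b a) /\
  (forall t (A : T -> Prop), (exists s, A s) -> (forall s, A s -> le s t) ->
      exists m, A m /\ forall s, A s -> le m s).

(* r(t) = order type of (0,t) is a limit ordinal: (0,t) nonempty with no maximum. *)
Definition rank_is_limit (t : T) : Prop :=
  (exists s, tree_lt s t) /\ ~ (exists m, tree_lt m t /\ forall s, tree_lt s t -> le s m).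

Definition hausdorff_tree : Prop :=
  forall t t', rank_is_limit t -> (forall s, tree_lt s t <-> tree_lt s t') -> t = t'.

(* Topology: the coarsest one in which every (0,t] is open and closed,
   i.e. generated by the subbasis {(0,t]} U {complement of (0,t]}. *)
Definition basic (l : list (bool * T)) (x : T) : Prop :=
  forall bt, In bt l -> if fst bt then le x (snd bt) else ~ le x (snd bt).

Definition tree_open (U : T -> Prop) : Prop :=
  forall x, U x -> exists l, basic l x /\ forall y, basic l y -> U y.

Definition tree_compact (K : T -> Prop) : Prop :=
  forall C : (T -> Prop) -> Prop,
    (forall U, C U -> tree_open U) ->
    (forall x, K x -> exists U, C U /\ U x) ->
    exists l : list (T -> Prop),
      (forall U, In U l -> C U) /\ (forall x, K x -> exists U, In U l /\ U x).

Definition tree_continuous (f : T -> R) : Prop :=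
  forall t eps, 0 < eps -> exists U, tree_open U /\ U t /\
    forall s, U s -> Rabs (f s - f t) < eps.

Definition inC0 (f : T -> R) : Prop :=
  tree_continuous f /\
  forall eps, 0 < eps -> tree_compact (fun t => eps <= Rabs (f t)).

(* m is the supremum norm of f (sup of |f t|, with sup of the empty family = 0). *)
Definition supnorm_is (f : T -> R) (m : R) : Prop :=
  is_lub (fun y => y = 0 \/ exists t, y = Rabs (f t)) m.

Definition fadd (f g : T -> R) : T -> R := fun t => f t + g t.
Definition fscal (a : R) (f : T -> R) : T -> R := fun t => a * f t.
Definition fsub (f g : T -> R) : T -> R := fun t => f t - g t.

Definition is_norm_C0 (N : (T -> R) -> R) : Prop :=
  (forall f, inC0 f -> 0 <= N f) /\
  (forall f, inC0 f -> N f = 0 -> forall t, f t = 0) /\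
  (forall a f, inC0 f -> N (fscal a f) = Rabs a * N f) /\
  (forall f g, inC0 f -> inC0 g -> N (fadd f g) <= N f + N g).

Definition equivalent_norm_C0 (N : (T -> R) -> R) : Prop :=
  is_norm_C0 N /\
  exists c C, 0 < c /\ 0 < C /\
    forall f m, inC0 f -> supnorm_is f m -> c * m <= N f /\ N f <= C * m.

Definition dual_elem (N : (T -> R) -> R) (phi : (T -> R) -> R) : Prop :=
  (forall f g, inC0 f -> inC0 g -> phi (fadd f g) = phi f + phi g) /\
  (forall a f, inC0 f -> phi (fscal a f) = a * phi f) /\
  (exists K, forall f, inC0 f -> Rabs (phi f) <= K * N f).

(* open subsets of C_0(Upsilon) (as predicates, only their trace on C_0 matters) *)
Definition weak_open (N : (T -> R) -> R) (U : (T -> R) -> Prop) : Prop :=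
  forall f, inC0 f -> U f ->
    exists (l : list ((T -> R) -> R)) (d : R),
      (forall phi, In phi l -> dual_elem N phi) /\ 0 < d /\
      forall g, inC0 g -> (forall phi, In phi l -> Rabs (phi g - phi f) < d) -> U g.

Definition norm_open (N : (T -> R) -> R) (U : (T -> R) -> Prop) : Prop :=
  forall f, inC0 f -> U f ->
    exists d, 0 < d /\ forall g, inC0 g -> N (fsub g f) < d -> U g.

Definition kadec (N : (T -> R) -> R) : Prop :=
  forall A : (T -> R) -> Prop,
    (exists U, weak_open N U /\ forall f, inC0 f -> N f = 1 -> (A f <-> U f)) <->
    (exists U, norm_open N U /\ forall f, inC0 f -> N f = 1 -> (A f <-> U f)).

Definition succ_of (t u : T) : Prop := forall s, tree_lt s u <-> le s t.

Definition tree_increasing (rho : T -> R) : Prop := forall s t, le s t -> rho s <= rho t.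

(* inf_{u in t^+ \ F} rho u > rho t (with inf of the empty set = +oo) *)
Definition good_point (rho : T -> R) (t : T) : Prop :=
  exists F : list T, (forall u, In u F -> succ_of t u) /\
    exists c, rho t < c /\ forall u, succ_of t u -> ~ In u F -> c <= rho u.

Definition bad_point (rho : T -> R) (t : T) : Prop := ~ good_point rho t.

End Tree.

(* Main.v *)
Require Import Defs.
From Stdlib Require Import Reals List Lra Lia Permutation Cantor.
From Stdlib Require Import Classical ClassicalEpsilon FunctionalExtensionality.
Import ListNotations.
Open Scope R_scope.

(** Necessity: let rho t be the infimum of the norms of the functions equal to 1 on (0,t] and to 0 at
    the points incomparable with t. If t were bad, there would be functions h_i nearly attaining
    rho t and equal to 1 on (0,u_i], for infinitely many distinct u_i in t^+. The differences of h_i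
    and the indicator of (0,t] are bounded and disjointly supported, so they tend weakly to 0, and
    averaging shows that the indicator of (0,t] itself has norm rho t: the Kadec property fails.

    Sufficiency: if every t is good, call a finite set F t of successors of t essential, so that
    passing from t to an inessential successor pushes rho past a rational number chosen at t. With
    defect f a = f a - sum of f over F a, the norm is built from the seminorms
      sup of sum_{a in A} |defect f a| + sum_{r in B} |f r| + |f s - f s'| / (k + 1),
    over finite sets A and antichains B of bounded size, no point of B being below a point of A,
    and over pairs s, s' which A and B do not separate. For large sizes the supremum for f grows
    arbitrarily little when one more point is allowed; hence f is nearly constant on unseparated
    pairs, since otherwise a point could be added with a definite gain. Moving the points of B
    upwards does not decrease the sum, because f r is redistributed over defects and successors; so
    we may assume f small on B. Any g close to f at finitely many points and with almost the same
    suprema is then uniformly close to f. *)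

(** Closeness at finitely many points only prevents a supremum of tests from dropping; what keeps a
    single supremum from rising is that the norm, a convergent weighted sum of such suprema, is
    fixed on the sphere. The pair (A, B) that nearly realises a supremum for f must also leave no
    room for g. A point above some r of B can be tested by exchanging it with r, and this yields a
    small bound only if f is small at r. Defects serve this purpose: the absolute value of f at a is
    at most that of the defect plus those at the essential successors, so a value can be handed
    upwards until it is small. The rational chosen at a supplies finiteness: along a branch it never
    serves twice, so only finitely many inessential steps have a rational of bounded index. The
    factor 1 / (k + 1) makes the oscillation term too weak, for large k, to outweigh the gain of one
    more point, while for g it still detects variation between unseparated points. *)

(** * Finite sums and selections from finite lists *)

Definition sumR {X : Type} (v : X -> R) (l : list X) : R :=
  fold_right (fun x s => v x + s) 0 l.

Lemma sumR_app {X} (v : X -> R) l l' : sumR v (l ++ l') = sumR v l + sumR v l'.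
Proof. induction l; simpl; lra. Qed.

Lemma sumR_nonneg {X} (v : X -> R) l : (forall x, In x l -> 0 <= v x) -> 0 <= sumR v l.
Proof.
  induction l as [|a l IH]; simpl; intros H; [lra|].
  assert (0 <= v a) by auto. assert (0 <= sumR v l) by auto. lra.
Qed.

Lemma sumR_le {X} (v w : X -> R) l :
  (forall x, In x l -> v x <= w x) -> sumR v l <= sumR w l.
Proof.
  induction l as [|a l IH]; simpl; intros H; [lra|].
  assert (v a <= w a) by auto. assert (sumR v l <= sumR w l) by auto. lra.
Qed.

Lemma sumR_ext {X} (v w : X -> R) l :
  (forall x, In x l -> v x = w x) -> sumR v l = sumR w l.
Proof. intros H; apply Rle_antisym; apply sumR_le; intros; rewrite H; auto; lra. Qed.

Lemma sumR_plus {X} (v w : X -> R) l :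
  sumR (fun x => v x + w x) l = sumR v l + sumR w l.
Proof. induction l; simpl; lra. Qed.

Lemma sumR_scal {X} (a : R) (v : X -> R) l :
  sumR (fun x => a * v x) l = a * sumR v l.
Proof. induction l as [|x l IH]; simpl; [|rewrite IH]; lra. Qed.

Lemma sumR_bound {X} (v : X -> R) l M :
  (forall x, In x l -> v x <= M) -> sumR v l <= INR (length l) * M.
Proof.
  induction l as [|a l IH]; intros H; [simpl; lra|].
  change (length (a :: l)) with (S (length l)). rewrite S_INR. simpl.
  assert (v a <= M) by (apply H; simpl; auto).
  assert (sumR v l <= INR (length l) * M) by (apply IH; intros; apply H; simpl; auto). lra.
Qed.

Lemma sumR_Rabs {X} (v : X -> R) l : Rabs (sumR v l) <= sumR (fun x => Rabs (v x)) l.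
Proof.
  induction l as [|a l IH]; simpl; [rewrite Rabs_R0; lra|].
  eapply Rle_trans; [apply Rabs_triang|]. lra.
Qed.

Lemma sumR_perm {X} (v : X -> R) l l' : Permutation l l' -> sumR v l = sumR v l'.
Proof. induction 1; simpl; lra. Qed.

Lemma list_filter {X} (P : X -> Prop) (l : list X) :
  exists l', forall x, In x l' <-> In x l /\ P x.
Proof.
  induction l as [|a l [l' H]]; [exists []; simpl; tauto|].
  destruct (classic (P a)) as [p|p].
  - exists (a :: l'). intros x; simpl. rewrite H. intuition (subst; auto).
  - exists l'. intros x; simpl. rewrite H. intuition (subst; tauto).
Qed.

Lemma list_partition {X} (P : X -> Prop) (l : list X) :
  exists l1 l2, Permutation l (l1 ++ l2) /\
    (forall x, In x l1 -> P x) /\ (forall x, In x l2 -> ~ P x).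
Proof.
  induction l as [|a l (l1 & l2 & H & H1 & H2)].
  - exists [], []. simpl. intuition.
  - destruct (classic (P a)) as [p|p].
    + exists (a :: l1), l2. simpl. repeat split; auto. intros x [->|]; auto.
    + exists l1, (a :: l2). repeat split; auto.
      * apply Permutation_cons_app; auto.
      * intros x [->|]; auto.
Qed.

Lemma uniform_nat {X} (P : X -> nat -> Prop) (l : list X) :
  (forall x m m', (m <= m')%nat -> P x m -> P x m') ->
  (forall x, In x l -> exists m, P x m) -> exists m, forall x, In x l -> P x m.
Proof.
  intros mono. induction l as [|a l IH]; intros H; [exists 0%nat; simpl; tauto|].
  destruct IH as [m Hm]; [intros; apply H; simpl; auto|].
  destruct (H a) as [m' Hm']; [simpl; auto|].
  exists (max m m'). intros x [->|i].
  - apply mono with m'; auto; lia.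
  - apply mono with m; auto; lia.
Qed.

Lemma uniform_pos {X} (P : X -> R -> Prop) (l : list X) :
  (forall x r r', r' <= r -> P x r -> P x r') ->
  (forall x, In x l -> exists r, 0 < r /\ P x r) ->
  exists r, 0 < r /\ forall x, In x l -> P x r.
Proof.
  intros mono. induction l as [|a l IH]; intros H.
  { exists 1. split; [lra|simpl; tauto]. }
  destruct IH as (m & Hm0 & Hm); [intros; apply H; simpl; auto|].
  destruct (H a) as (m' & Hm0' & Hm'); [simpl; auto|].
  exists (Rmin m m'). split; [apply Rmin_glb_lt; auto|]. intros x [->|i].
  - apply mono with m'; auto; apply Rmin_r.
  - apply mono with m; auto; apply Rmin_l.
Qed.

Lemma list_collect {X Y} (P : X -> Y -> Prop) (l : list X) :
  (forall x, In x l -> exists ly, forall y, P x y -> In y ly) ->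
  exists ly, forall x y, In x l -> P x y -> In y ly.
Proof.
  induction l as [|a l IH]; intros H; [exists []; simpl; tauto|].
  destruct IH as [l1 H1]; [intros; apply H; simpl; auto|].
  destruct (H a) as [l2 H2]; [simpl; auto|].
  exists (l1 ++ l2). intros x y [->|i] p; apply in_or_app; eauto.
Qed.

(** At most [M] entries can reach [eta], so as long as more than [n] are left, one below [eta] can
    be discarded. The price [Rmax eta 0] of a removal is nonnegative, which also covers stopping
    early. *)
Lemma sumR_drop_small {X} (v : X -> R) (eta : R) (M n : nat) (Mn : (M <= n)%nat) (m : nat) :
  forall l, NoDup l ->
  (forall l', NoDup l' -> incl l' l -> (forall x, In x l' -> eta <= v x) -> (length l' <= M)%nat) ->
  (length l <= n + m)%nat ->
  exists l', NoDup l' /\ incl l' l /\ (length l' <= n)%nat /\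
    sumR v l <= sumR v l' + INR m * Rmax eta 0.
Proof.
  induction m as [|m IH]; intros l nd big len.
  - exists l. repeat split; auto; [apply incl_refl|lia|simpl; lra].
  - rewrite S_INR.
    assert (e0 : 0 <= Rmax eta 0) by apply Rmax_r.
    assert (m0 : 0 <= INR m) by apply pos_INR.
    destruct (Nat.le_gt_cases (length l) n) as [L|L].
    { exists l. repeat split; auto; [apply incl_refl|nra]. }
    destruct (classic (exists x, In x l /\ v x < eta)) as [(x & xl & vx)|no].
    2:{ assert (length l <= M)%nat; [|lia]. apply big; auto; [apply incl_refl|].
        intros x xl. destruct (Rle_lt_dec eta (v x)); auto. exfalso; eauto. }
    destruct (in_split _ _ xl) as (l1 & l2 & ->).
    destruct (IH (l1 ++ l2)) as (l' & nd' & inc & len' & S).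
    + eapply NoDup_remove_1; eauto.
    + intros l' nd' inc b. apply big; auto. intros y yl. apply inc in yl.
      apply in_app_or in yl. apply in_or_app. simpl. tauto.
    + rewrite length_app in *. simpl in len. lia.
    + exists l'. repeat split; auto.
      * intros y yl. apply inc in yl.
        apply in_app_or in yl. apply in_or_app. simpl. tauto.
      * rewrite sumR_app in *. simpl. pose proof (Rmax_l eta 0). lra.
Qed.

(** * Trees and their topology *)

Section Order.
Context {T : Type} {le : T -> T -> Prop} (Htree : is_tree le).
Local Notation "s ≼ t" := (le s t) (at level 70).

Lemma le_refl t : t ≼ t.
Proof. apply Htree. Qed.
Lemma le_anti s t : s ≼ t -> t ≼ s -> s = t.
Proof. destruct Htree as (_ & H & _). apply H. Qed.
Lemma le_tr s t u : s ≼ t -> t ≼ u -> s ≼ u.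
Proof. destruct Htree as (_ & _ & H & _). apply H. Qed.
Lemma le_chain a b t : a ≼ t -> b ≼ t -> a ≼ b \/ b ≼ a.
Proof. destruct Htree as (_ & _ & _ & H & _). apply H. Qed.
Lemma le_least t (A : T -> Prop) : (exists s, A s /\ s ≼ t) ->
  exists m, A m /\ m ≼ t /\ forall s, A s -> s ≼ t -> m ≼ s.
Proof.
  intros (s & As & st). destruct Htree as (_ & _ & _ & _ & H).
  destruct (H t (fun s => A s /\ s ≼ t)) as (m & [Am mt] & min); [eauto|tauto|].
  exists m; auto.
Qed.

Lemma succ_lt a u : succ_of le a u -> a ≼ u /\ a <> u.
Proof. intros H. apply (H a). apply le_refl. Qed.

Lemma succ_pred a u z : succ_of le a u -> z ≼ u -> z <> u -> z ≼ a.
Proof. intros H zu n. apply H. split; auto. Qed.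

Lemma succ_pred_unique a a' u : succ_of le a u -> succ_of le a' u -> a = a'.
Proof.
  intros H H'. apply le_anti.
  - apply (succ_pred _ u); auto; apply succ_lt; auto.
  - apply (succ_pred _ u); auto; apply succ_lt; auto.
Qed.

Lemma succ_eq_of_le a u u' : succ_of le a u -> succ_of le a u' -> u ≼ u' -> u = u'.
Proof.
  intros H H' l. destruct (classic (u = u')) as [|n]; auto. exfalso.
  assert (u ≼ a) by (apply (succ_pred _ u'); auto).
  destruct (succ_lt _ _ H). auto using le_anti.
Qed.

Lemma succ_eq_of_bound a u u' t : succ_of le a u -> succ_of le a u' -> u ≼ t -> u' ≼ t -> u = u'.
Proof.
  intros H H' l l'. destruct (le_chain _ _ _ l l').
  - eapply succ_eq_of_le; eauto.
  - symmetry. eapply succ_eq_of_le; eauto.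
Qed.

Lemma succ_not_le_pred a u : succ_of le a u -> ~ u ≼ a.
Proof. intros H l. destruct (succ_lt _ _ H). auto using le_anti. Qed.

Lemma succ_toward a t : a ≼ t -> a <> t -> exists u, succ_of le a u /\ u ≼ t.
Proof.
  intros l n.
  destruct (le_least t (fun z => a ≼ z /\ a <> z)) as (u & [au nu] & ut & min).
  { exists t. auto using le_refl. }
  exists u. split; auto. intros s; split.
  - intros [su ns]. assert (s ≼ t) by (eapply le_tr; eauto).
    destruct (le_chain s a t) as [|h]; auto.
    destruct (classic (a = s)) as [->|n']; [apply le_refl|].
    exfalso. apply ns. apply le_anti; auto.
  - intros sa. split; [eapply le_tr; eauto|]. intros ->. apply nu, le_anti; auto.
Qed.

Lemma succ_or_limit x y : x ≼ y -> x <> y ->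
  (exists a, x ≼ a /\ succ_of le a y) \/
  (forall m, m ≼ y -> m <> y -> exists a, m ≼ a /\ m <> a /\ a ≼ y /\ a <> y).
Proof.
  intros xy n.
  destruct (classic (forall m, m ≼ y -> m <> y -> exists a, m ≼ a /\ m <> a /\ a ≼ y /\ a <> y))
    as [|H]; auto.
  left. apply not_all_ex_not in H. destruct H as [m H].
  apply imply_to_and in H. destruct H as [my H].
  apply imply_to_and in H. destruct H as [ny H].
  assert (P : forall s, s ≼ y -> s <> y -> s ≼ m).
  { intros s sy ns. destruct (le_chain s m y) as [|ms]; auto.
    destruct (classic (m = s)) as [->|nn]; [apply le_refl|]. exfalso; eauto 10. }
  exists m. split; auto. intros s; split.
  - intros [sy ns]; auto.
  - intros sm. split; [eapply le_tr; eauto|]. intros ->. auto using le_anti.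
Qed.

Hypothesis Hhaus : hausdorff_tree le.

(** This is where the Hausdorff condition enters. The first point [v] of (0,s] outside (0,t] and the
    first point [w] of (0,t] outside (0,s] have the same strict predecessors; if these had no
    maximum, [v] and [w] would be equal. The point [z] rules out different roots. *)
Lemma meet_exists s t z : z ≼ s -> z ≼ t ->
  exists m, m ≼ s /\ m ≼ t /\ forall y, y ≼ s -> y ≼ t -> y ≼ m.
Proof.
  intros zs zt.
  destruct (classic (s ≼ t)) as [st|st].
  { exists s. auto using le_refl. }
  destruct (classic (t ≼ s)) as [ts|ts].
  { exists t. auto using le_refl. }
  destruct (le_least s (fun y => ~ y ≼ t)) as (v & vt & vs & vmin).
  { exists s. auto using le_refl. }
  destruct (le_least t (fun y => ~ y ≼ s)) as (w & ws & wt & wmin).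
  { exists t. auto using le_refl. }
  assert (below : forall p q x y, p ≼ x -> ~ p ≼ y -> q ≼ x -> q ≼ y -> q ≼ p /\ q <> p).
  { intros p q x y px py qx qy. destruct (le_chain p q x) as [pq|qp]; auto.
    - exfalso. apply py. eapply le_tr; eauto.
    - split; auto. congruence. }
  assert (lv : forall y, tree_lt le y v <-> y ≼ s /\ y ≼ t).
  { intros y; split.
    - intros [yv n]. assert (y ≼ s) by (eapply le_tr; eauto). split; auto.
      apply NNPP. intros yt. apply n, le_anti; auto.
    - intros [ys yt]. apply (below v y s t); auto. }
  assert (lw : forall y, tree_lt le y w <-> y ≼ s /\ y ≼ t).
  { intros y; split.
    - intros [yv n]. assert (y ≼ t) by (eapply le_tr; eauto). split; auto.
      apply NNPP. intros yt. apply n, le_anti; auto.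
    - intros [ys yt]. apply (below w y t s); auto. }
  destruct (classic (exists m, tree_lt le m v /\ forall y, tree_lt le y v -> y ≼ m))
    as [(m & mv & max)|nomax].
  - exists m. apply lv in mv. destruct mv. repeat split; auto.
    intros y ys yt. apply max, lv. auto.
  - exfalso. assert (e : v = w).
    { apply Hhaus.
      - split; auto. exists z. apply lv; auto.
      - intros y. rewrite lv, lw. tauto. }
    subst. auto.
Qed.

Lemma open_basic l : tree_open le (basic le l).
Proof. intros x Hx. exists l; auto. Qed.

Lemma basic_app l l' x : basic le (l ++ l') x <-> basic le l x /\ basic le l' x.
Proof.
  unfold basic; split.
  - intros H; split; intros bt i; apply H, in_or_app; auto.
  - intros [H H'] bt i. apply in_app_or in i. destruct i; [apply H|apply H']; auto.
Qed.

Lemma basic_convex l z z' y : basic le l z -> basic le l y -> z ≼ z' -> z' ≼ y -> basic le l z'.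
Proof.
  intros Hz Hy l1 l2 [b t] i. specialize (Hz _ i); specialize (Hy _ i); simpl in *.
  destruct b.
  - eapply le_tr; eauto.
  - intros h. apply Hz. eapply le_tr; eauto.
Qed.

(** Each excluded interval (0,t] meets (0,y] in some (0,m] with m < y, or not at all. As [y] has no
    immediate predecessor, finitely many such [m] can be passed while staying below [y]. *)
Lemma basic_limit l x y : x ≼ y -> x <> y ->
  (forall m, m ≼ y -> m <> y -> exists a, m ≼ a /\ m <> a /\ a ≼ y /\ a <> y) ->
  basic le l y -> exists a, x ≼ a /\ a ≼ y /\ a <> y /\ basic le l a.
Proof.
  intros xy n lim. induction l as [|[b t] l IH]; intros H.
  { exists x. repeat split; auto using le_refl. intros bt []. }
  destruct IH as (a & xa & ay & ny & Ha).
  { intros bt i. apply H. simpl; auto. }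
  assert (Hy : basic le l y) by (intros bt i; apply H; simpl; auto).
  assert (Ht := H (b, t) (or_introl eq_refl)). simpl in Ht.
  destruct b.
  { exists a. repeat split; auto. intros bt [<-|i]; [simpl; eapply le_tr; eauto|exact (Ha _ i)]. }
  assert (goal : forall a', a ≼ a' -> a' ≼ y -> a' <> y -> ~ a' ≼ t ->
            exists a, x ≼ a /\ a ≼ y /\ a <> y /\ basic le ((false, t) :: l) a).
  { intros a' aa' a'y n' h. exists a'. repeat split; auto.
    - eapply le_tr; eauto.
    - intros bt [<-|i]; [exact h|].
      exact (basic_convex l a a' y Ha Hy aa' a'y _ i). }
  destruct (classic (a ≼ t)) as [at'|at'].
  2:{ apply (goal a); auto using le_refl. }
  destruct (meet_exists y t a) as (m & my & mt & max); auto.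
  destruct (lim m) as (a' & ma & na & a'y & n'); auto.
  { intros ->; auto. }
  apply (goal a'); auto.
  - eapply le_tr; [apply max|]; eauto.
  - intros h. apply na, le_anti; auto.
Qed.

(** The interval [(0,x]] is compact by induction along the well-ordered set [(0,x]]: a basic
    neighbourhood of [y] omits only finitely many intervals [(0,m]] with [m < y]. *)
Lemma compact_interval x : tree_compact le (fun t => t ≼ x).
Proof.
  intros C Cop Ccov.
  set (fin := fun y => exists l, (forall U, In U l -> C U) /\
                 forall z, z ≼ y -> exists U, In U l /\ U z).
  apply NNPP. intros nf.
  destruct (le_least x (fun y => ~ fin y)) as (y & ny & yx & ymin).
  { exists x. split; auto using le_refl. }
  destruct (Ccov y yx) as (U & CU & Uy).
  destruct (Cop U CU y Uy) as (l & ly & lU).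
  apply ny. clear nf.
  assert (IH : exists L, (forall U, In U L -> C U) /\
     forall z, z ≼ y -> ~ basic le l z -> exists U, In U L /\ U z).
  { assert (ly' : forall bt, In bt l -> if fst bt then y ≼ snd bt else ~ y ≼ snd bt) by exact ly.
    clear ly lU. induction l as [|[b t] l IH].
    { exists []. split; [simpl; tauto|]. intros z _ h. exfalso. apply h. intros bt []. }
    destruct IH as (L & LC & Lc); [intros; apply ly'; simpl; auto|].
    assert (Ht := ly' (b, t) (or_introl eq_refl)). simpl in Ht.
    assert (spl : forall z, ~ basic le ((b, t) :: l) z -> ~ (if b then z ≼ t else ~ z ≼ t) \/ ~ basic le l z).
    { intros z h. destruct (classic (basic le l z)) as [H|]; auto. left. intros h'. apply h.
      intros bt [<-|i]; [exact h'|exact (H _ i)]. }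
    destruct b.
    { exists L. split; auto. intros z zy h. destruct (spl z h) as [h'|]; auto.
      exfalso. apply h'. eapply le_tr; eauto. }
    destruct (classic (exists z, z ≼ y /\ z ≼ t)) as [(z0 & z0y & z0t)|no].
    2:{ exists L. split; auto. intros z zy h. destruct (spl z h) as [h'|]; auto.
        exfalso. apply h'. intros zt; eauto. }
    destruct (meet_exists y t z0) as (m & my & mt & max); auto.
    assert (fm : fin m).
    { apply NNPP. intros nm. apply Ht. apply (le_tr y m t); auto.
      apply ymin; auto. apply (le_tr m y x); auto. }
    destruct fm as (L' & LC' & Lc').
    exists (L ++ L'). split.
    - intros V i. apply in_app_or in i. destruct i; auto.
    - intros z zy h. destruct (spl z h) as [h'|h'].
      + apply NNPP in h'. destruct (Lc' z) as (V & i & Vz); auto.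
        exists V. split; auto. apply in_or_app; auto.
      + destruct (Lc z) as (V & i & Vz); auto.
        exists V. split; auto. apply in_or_app; auto. }
  destruct IH as (L & LC & Lc).
  exists (U :: L). split.
  - intros V [<-|i]; auto.
  - intros z zy. destruct (classic (basic le l z)) as [b|b].
    + exists U. simpl; auto.
    + destruct (Lc z) as (V & i & Vz); auto. exists V; simpl; auto.
Qed.

(** * Finite unions of initial intervals *)

Definition down (X : list T) (t : T) : Prop := exists x, In x X /\ t ≼ x.

Lemma down_le X s t : s ≼ t -> down X t -> down X s.
Proof. intros st (x & i & tx). exists x. split; auto. eapply le_tr; eauto. Qed.

Lemma compact_down X : tree_compact le (down X).
Proof.
  intros C Cop Ccov.
  induction X as [|x X IH].
  { exists []. split; [simpl; tauto|]. intros z (x & [] & _). }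
  destruct IH as (L & LC & Lc).
  { intros z (y & i & h). apply Ccov. exists y; simpl; auto. }
  destruct (compact_interval x C Cop) as (L' & LC' & Lc').
  { intros z h. apply Ccov. exists x; simpl; auto. }
  exists (L ++ L'). split.
  - intros V i. apply in_app_or in i. destruct i; auto.
  - intros z (y & [<-|i] & h).
    + destruct (Lc' z) as (V & i & Vz); auto. exists V. split; auto. apply in_or_app; auto.
    + destruct (Lc z) as (V & j & Vz); [exists y; auto|]. exists V. split; auto. apply in_or_app; auto.
Qed.

(** Compactness of [down X] in the form used below: each neighbourhood stays paired with the centre
    for which it was chosen, because [Q] relates the two. *)
Lemma finite_centers X (Q : T -> (T -> Prop) -> Prop) :
  (forall y, down X y -> exists U, tree_open le U /\ U y /\ Q y U) ->
  exists W, forall z, down X z -> exists w U, In w W /\ down X w /\ Q w U /\ U z.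
Proof.
  intros H.
  destruct (compact_down X (fun U => tree_open le U /\ exists y, down X y /\ Q y U)) as (L & LC & Lc).
  - tauto.
  - intros x hx. destruct (H x hx) as (U & o & Ux & q). exists U; eauto 10.
  - assert (E : exists W, forall U, In U L -> exists w, In w W /\ down X w /\ Q w U).
    { clear Lc. induction L as [|U L IH]; [exists []; simpl; tauto|].
      destruct IH as (W & HW); [intros; apply LC; simpl; auto|].
      destruct (LC U) as (_ & y & dy & q); [simpl; auto|].
      exists (y :: W). intros V [<-|i].
      - exists y. simpl; auto.
      - destruct (HW V i) as (w & iw & dw & qw). exists w. simpl; auto. }
    destruct E as (W & HW). exists W. intros z dz.
    destruct (Lc z dz) as (U & i & Uz). destruct (HW U i) as (w & iw & dw & q).
    exists w, U; auto.
Qed.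

End Order.
(** * The space C_0 *)

Section Functions.
Context {T : Type} {le : T -> T -> Prop} (Htree : is_tree le) (Hhaus : hausdorff_tree le).
Local Notation "s ≼ t" := (le s t) (at level 70).

Lemma open_interval x : tree_open le (fun t => t ≼ x).
Proof.
  intros t tx. exists [(true, x)]. split.
  - intros bt [<-|[]]; exact tx.
  - intros y H. exact (H (true, x) (or_introl eq_refl)).
Qed.

Lemma open_inter U V : tree_open le U -> tree_open le V -> tree_open le (fun t => U t /\ V t).
Proof.
  intros HU HV x [Ux Vx].
  destruct (HU x Ux) as (l & lx & lU), (HV x Vx) as (l' & lx' & lV).
  exists (l ++ l'). split; [apply basic_app; auto|].
  intros y Hy. apply basic_app in Hy. destruct Hy; auto.
Qed.

Lemma C0_cover f eps : inC0 le f -> 0 < eps ->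
  exists X, forall t, eps <= Rabs (f t) -> down (le := le) X t.
Proof.
  intros [_ H] e.
  destruct (H eps e (fun U => exists x, forall t, U t <-> t ≼ x)) as (L & LC & Lc).
  - intros U (x & Ux) t Ut. apply Ux in Ut.
    destruct (open_interval x t Ut) as (l & lt & lU).
    exists l. split; auto. intros y Hy. apply Ux; auto.
  - intros x _. exists (fun t => t ≼ x). split; [exists x; tauto|apply (le_refl Htree)].
  - assert (E : exists X, forall U, In U L -> exists x, In x X /\ forall t, U t <-> t ≼ x).
    { clear Lc. induction L as [|U L IH]; [exists []; simpl; tauto|].
      destruct IH as (X & HX); [intros; apply LC; simpl; auto|].
      destruct (LC U) as (x & Ux); [simpl; auto|].
      exists (x :: X). intros V [<-|i].
      - exists x. simpl; auto.
      - destruct (HX V i) as (y & iy & Hy). exists y; simpl; auto. }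
    destruct E as (X & HX). exists X. intros t ht.
    destruct (Lc t ht) as (U & i & Ut). destruct (HX U i) as (x & ix & Hx).
    exists x. split; auto. apply Hx; auto.
Qed.

(** Adjoining the open set [V] where [f] is below [eps] turns a cover of the level set into a cover
    of the compact set [down X]; as [V] misses the level set, it can be removed again from the
    finite subcover. *)
Lemma C0_of_cover f : tree_continuous le f ->
  (forall eps, 0 < eps -> exists X, forall t, eps <= Rabs (f t) -> down (le := le) X t) ->
  inC0 le f.
Proof.
  intros cont cov. split; auto. intros eps e C Cop Ccov.
  destruct (cov eps e) as (X & HX).
  set (V := fun t => Rabs (f t) < eps).
  assert (Vop : tree_open le V).
  { intros t Vt. destruct (cont t (eps - Rabs (f t))) as (U & Uop & Ut & HU); [unfold V in Vt; lra|].
    destruct (Uop t Ut) as (l & lt & lU). exists l. split; auto. intros y Hy.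
    specialize (HU y (lU y Hy)). unfold V.
    replace (f y) with ((f y - f t) + f t) by lra.
    eapply Rle_lt_trans; [apply Rabs_triang|]. lra. }
  destruct (compact_down Htree Hhaus X (fun U => C U \/ U = V)) as (L & LC & Lc).
  - intros U [h| ->]; auto.
  - intros x _. destruct (Rle_lt_dec eps (Rabs (f x))) as [h|h].
    + destruct (Ccov x h) as (U & CU & Ux). exists U; auto.
    + exists V; auto.
  - destruct (list_filter C L) as (L' & HL').
    exists L'. split; [intros U i; apply HL' in i; tauto|].
    intros x hx. destruct (Lc x (HX x hx)) as (U & i & Ux).
    exists U. split; auto. apply HL'. split; auto.
    destruct (LC U i) as [|e']; auto. subst. unfold V in Ux. lra.
Qed.

Lemma continuous_add f g : tree_continuous le f -> tree_continuous le g ->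
  tree_continuous le (fadd f g).
Proof.
  intros Hf Hg t eps e.
  destruct (Hf t (eps/2)) as (U & Uop & Ut & HU); [lra|].
  destruct (Hg t (eps/2)) as (V & Vop & Vt & HV); [lra|].
  exists (fun t => U t /\ V t). split; [apply open_inter; auto|]. split; auto.
  intros s [Us Vs]. unfold fadd.
  replace (f s + g s - (f t + g t)) with ((f s - f t) + (g s - g t)) by lra.
  eapply Rle_lt_trans; [apply Rabs_triang|].
  specialize (HU s Us). specialize (HV s Vs). lra.
Qed.

Lemma continuous_scal a f : tree_continuous le f -> tree_continuous le (fscal a f).
Proof.
  intros Hf t eps e. pose proof (Rabs_pos a).
  destruct (Hf t (eps / (Rabs a + 1))) as (U & Uop & Ut & HU).
  { apply Rdiv_lt_0_compat; lra. }
  exists U. split; auto. split; auto. intros s Us. specialize (HU s Us).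
  unfold fscal. replace (a * f s - a * f t) with (a * (f s - f t)) by lra.
  rewrite Rabs_mult.
  assert ((Rabs a + 1) * Rabs (f s - f t) < eps).
  { replace eps with ((Rabs a + 1) * (eps / (Rabs a + 1))) by (field; lra).
    apply Rmult_lt_compat_l; lra. }
  pose proof (Rabs_pos (f s - f t)). lra.
Qed.

Lemma C0_add f g : inC0 le f -> inC0 le g -> inC0 le (fadd f g).
Proof.
  intros Hf Hg. apply C0_of_cover.
  - apply continuous_add; [apply Hf|apply Hg].
  - intros eps e.
    destruct (C0_cover f (eps/2) Hf) as (X & HX); [lra|].
    destruct (C0_cover g (eps/2) Hg) as (Y & HY); [lra|].
    exists (X ++ Y). intros t ht. unfold fadd in ht.
    pose proof (Rabs_triang (f t) (g t)).
    destruct (Rle_lt_dec (eps/2) (Rabs (f t))) as [h|h].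
    + destruct (HX t h) as (x & i & tx). exists x. split; auto. apply in_or_app; auto.
    + destruct (HY t) as (x & i & tx); [lra|]. exists x. split; auto. apply in_or_app; auto.
Qed.

Lemma C0_scal a f : inC0 le f -> inC0 le (fscal a f).
Proof.
  intros Hf. apply C0_of_cover.
  - apply continuous_scal. apply Hf.
  - intros eps e. pose proof (Rabs_pos a).
    destruct (C0_cover f (eps / (Rabs a + 1)) Hf) as (X & HX).
    { apply Rdiv_lt_0_compat; lra. }
    exists X. intros t ht. apply HX. unfold fscal in ht. rewrite Rabs_mult in ht.
    apply (Rmult_le_reg_l (Rabs a + 1)); [lra|].
    replace ((Rabs a + 1) * (eps / (Rabs a + 1))) with eps by (field; lra).
    pose proof (Rabs_pos (f t)). lra.
Qed.

Lemma fsub_fadd (f g : T -> R) : fsub f g = fadd f (fscal (-1) g).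
Proof. apply functional_extensionality. intros t. unfold fsub, fadd, fscal. lra. Qed.

Lemma C0_sub f g : inC0 le f -> inC0 le g -> inC0 le (fsub f g).
Proof. intros Hf Hg. rewrite fsub_fadd. apply C0_add; auto. apply C0_scal; auto. Qed.

Lemma C0_zero : inC0 le (fun _ => 0).
Proof.
  apply C0_of_cover.
  - intros t eps e. exists (fun _ => True). split; [|split; auto].
    + intros x _. exists []. split; auto. intros bt [].
    + intros s _. rewrite Rminus_diag, Rabs_R0. auto.
  - intros eps e. exists []. intros t. rewrite Rabs_R0. lra.
Qed.

Definition indic (x t : T) : R := if excluded_middle_informative (t ≼ x) then 1 else 0.

Lemma indic_in x t : t ≼ x -> indic x t = 1.
Proof. unfold indic. destruct (excluded_middle_informative (t ≼ x)); tauto. Qed.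

Lemma indic_out x t : ~ t ≼ x -> indic x t = 0.
Proof. unfold indic. destruct (excluded_middle_informative (t ≼ x)); tauto. Qed.

Lemma C0_indic x : inC0 le (indic x).
Proof.
  apply C0_of_cover.
  - intros t eps e. destruct (classic (t ≼ x)) as [h|h].
    + exists (fun t => t ≼ x). split; [apply open_interval|]. split; auto.
      intros s hs. rewrite !indic_in, Rminus_diag, Rabs_R0; auto.
    + exists (fun t => ~ t ≼ x). split; [|split; auto].
      * intros s hs. exists [(false, x)]. split.
        -- intros bt [<-|[]]; exact hs.
        -- intros y H. exact (H (false, x) (or_introl eq_refl)).
      * intros s hs. rewrite !indic_out, Rminus_diag, Rabs_R0; auto.
  - intros eps e. exists [x]. intros t ht. exists x. simpl. split; auto.
    apply NNPP. intros h. rewrite indic_out, Rabs_R0 in ht; auto. lra.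
Qed.

Lemma C0_bounded f : inC0 le f -> exists M, forall t, Rabs (f t) <= M.
Proof.
  intros Hf. destruct (C0_cover f 1 Hf) as (X & HX); [lra|].
  destruct (finite_centers Htree Hhaus X (fun y U => forall s, U s -> Rabs (f s - f y) < 1))
    as (W & HW).
  { intros y _. destruct Hf as [cont _]. apply cont. lra. }
  assert (E : exists M, 0 <= M /\ forall w, In w W -> Rabs (f w) <= M).
  { clear. induction W as [|w W (M & M0 & HM)]; [exists 0; simpl; split; [lra|tauto]|].
    exists (Rmax M (Rabs (f w))). split; [eapply Rle_trans; [|apply Rmax_l]; auto|].
    intros x [<-|i]; [apply Rmax_r|]. eapply Rle_trans; [|apply Rmax_l]; auto. }
  destruct E as (M & M0 & HM). exists (M + 1). intros t.
  destruct (Rle_lt_dec 1 (Rabs (f t))) as [h|h]; [|lra].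
  destruct (HW t (HX t h)) as (w & U & i & _ & HU & Ut).
  specialize (HU t Ut). specialize (HM w i).
  replace (f t) with ((f t - f w) + f w) by lra.
  eapply Rle_trans; [apply Rabs_triang|]. lra.
Qed.

Lemma supnorm_exists f : inC0 le f -> exists m, supnorm_is f m.
Proof.
  intros Hf. destruct (C0_bounded f Hf) as (M & HM).
  destruct (completeness (fun y => y = 0 \/ exists t, y = Rabs (f t))) as (m & Hm).
  - exists (Rmax M 0). intros y [->|(t & ->)]; [apply Rmax_r|].
    eapply Rle_trans; [apply HM|apply Rmax_l].
  - exists 0; auto.
  - exists m; auto.
Qed.

Lemma equivalent_norm_bounds N : equivalent_norm_C0 le N ->
  exists c C, 0 < c /\ 0 < C /\
    (forall f t, inC0 le f -> c * Rabs (f t) <= N f) /\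
    (forall f B, inC0 le f -> 0 <= B -> (forall t, Rabs (f t) <= B) -> N f <= C * B).
Proof.
  intros (_ & c & C & c0 & C0 & H). exists c, C. repeat split; auto.
  - intros f t Hf. destruct (supnorm_exists f Hf) as (m & Hm).
    destruct (H f m Hf Hm) as [h _]. eapply Rle_trans; [|apply h].
    apply Rmult_le_compat_l; [lra|]. apply Hm. eauto.
  - intros f B Hf B0 HB. destruct (supnorm_exists f Hf) as (m & Hm).
    destruct (H f m Hf Hm) as [_ h]. eapply Rle_trans; [apply h|].
    apply Rmult_le_compat_l; [lra|]. apply Hm. intros y [->|(t & ->)]; auto.
Qed.

End Functions.

(** * From a Kadec norm to an increasing function *)

Section Necessity.
Context {T : Type} {le : T -> T -> Prop} (Htree : is_tree le) (Hhaus : hausdorff_tree le).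
Context (N : (T -> R) -> R) (HN : equivalent_norm_C0 le N).
Local Notation "s ≼ t" := (le s t) (at level 70).

(** The values strictly above [t] are free. This makes the condition weaker at smaller points, hence
    the infimum of the norms increasing in [t]. *)
Definition extends_one (t : T) (h : T -> R) : Prop :=
  inC0 le h /\ (forall z, z ≼ t -> h z = 1) /\ (forall z, ~ z ≼ t -> ~ t ≼ z -> h z = 0).

Lemma extends_one_indic t : extends_one t (indic (le := le) t).
Proof.
  split; [apply C0_indic; auto|]. split.
  - intros; apply indic_in; auto.
  - intros; apply indic_out; auto.
Qed.

Lemma extends_one_mono s t h : s ≼ t -> extends_one t h -> extends_one s h.
Proof.
  intros st (Hc & H1 & H0). split; auto. split.
  - intros z zs. apply H1. eapply le_tr; eauto.
  - intros z nzs nsz. apply H0.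
    + intros zt. destruct (le_chain Htree z s t); auto.
    + intros tz. apply nsz. eapply le_tr; eauto.
Qed.

Lemma inf_norm_exists : exists rho : T -> R, forall t,
  (forall h, extends_one t h -> rho t <= N h) /\
  (forall d, 0 < d -> exists h, extends_one t h /\ N h < rho t + d).
Proof.
  set (P := fun t r => (forall h, extends_one t h -> r <= N h) /\
     (forall d, 0 < d -> exists h, extends_one t h /\ N h < r + d)).
  exists (fun t => epsilon (inhabits 0) (P t)). intros t. apply (epsilon_spec (inhabits 0) (P t)).
  destruct (completeness (fun y => exists h, extends_one t h /\ y = - N h)) as (m & ub & lub).
  - exists 0. intros y (h & Hh & ->). destruct HN as ((pos & _) & _).
    specialize (pos h (proj1 Hh)). lra.
  - exists (- N (indic (le := le) t)). exists (indic (le := le) t). split; auto. apply extends_one_indic.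
  - exists (- m). split.
    + intros h Hh. assert (- N h <= m) by (apply ub; eauto). lra.
    + intros d d0. apply NNPP. intros no.
      assert (m <= m - d); [|lra]. apply lub. intros y (h & Hh & ->).
      destruct (Rle_lt_dec (- N h) (m - d)); auto. exfalso. apply no. exists h. split; auto. lra.
Qed.

Lemma dual_sub (phi : (T -> R) -> R) f g : dual_elem le N phi ->
  inC0 le f -> inC0 le g -> phi (fsub f g) = phi f - phi g.
Proof.
  intros (add & scal & _) Hf Hg. rewrite fsub_fadd, add, scal; auto; [lra|].
  apply C0_scal; auto.
Qed.

(** * Fans of functions over distinct immediate successors of a point *)

Section Fan.
Context (t : T) (B : R) (B0 : 0 <= B) (l : list (T * (T -> R))) (nd : NoDup (map fst l))
  (Hl : forall p, In p l -> succ_of le t (fst p) /\ extends_one (fst p) (snd p) /\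
     forall z, Rabs (snd p z - indic (le := le) t z) <= B).

Definition deviation (p : T * (T -> R)) : T -> R := fsub (snd p) (indic (le := le) t).
Definition fan_sum (s : T * (T -> R) -> R) : T -> R :=
  fun z => sumR (fun p => s p * deviation p z) l.

Lemma deviation_support p z : In p l -> ~ fst p ≼ z -> deviation p z = 0.
Proof.
  intros i n. destruct (Hl p i) as (su & (_ & h1 & h0) & _).
  destruct (succ_lt Htree _ _ su) as [tu _].
  unfold deviation, fsub. destruct (classic (z ≼ t)) as [zt|zt].
  - rewrite h1, indic_in; auto; [lra|]. eapply le_tr; eauto.
  - rewrite h0, indic_out; auto; [lra|]. intros zu. apply zt. eapply succ_pred; eauto.
    intros ->. apply n, le_refl; auto.
Qed.

(** Distinct immediate successors have no common upper bound, so at most one deviation is nonzero at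
    [z]. Hence the bound does not grow with the length of the list. *)
Lemma fan_sum_bound s z : (forall p, Rabs (s p) <= 1) -> Rabs (fan_sum s z) <= B.
Proof.
  intros Hs. unfold fan_sum.
  assert (one : forall p, In p l -> Rabs (s p * deviation p z) <= B).
  { intros p i. rewrite Rabs_mult. destruct (Hl p i) as (_ & _ & b).
    specialize (b z). change (snd p z - indic t z) with (deviation p z) in b.
    pose proof (Rabs_pos (deviation p z)). pose proof (Rabs_pos (s p)). specialize (Hs p). nra. }
  assert (supp := fun p => deviation_support p z).
  assert (su : forall p, In p l -> succ_of le t (fst p)) by (intros; apply Hl; auto).
  clear Hl. induction l as [|p l' IH]; simpl; [rewrite Rabs_R0; auto|].
  simpl in nd. inversion nd as [|? ? nin nd']; subst.
  destruct (classic (fst p ≼ z)) as [h|h].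
  - assert (E : sumR (fun p => s p * deviation p z) l' = 0).
    { rewrite (sumR_ext _ (fun _ => 0 * 0)).
      - rewrite sumR_scal. lra.
      - intros q i. rewrite supp; simpl; auto; [lra|].
        intros qz. apply nin. rewrite (succ_eq_of_bound Htree t (fst p) (fst q) z); auto.
        + apply in_map; auto.
        + apply su; simpl; auto.
        + apply su; simpl; auto. }
    rewrite E, Rplus_0_r. apply one; simpl; auto.
  - rewrite (supp p); simpl; auto. rewrite Rmult_0_r, Rplus_0_l.
    apply IH; intros; auto; [apply one|apply supp|apply su]; simpl; auto.
Qed.

Lemma fan_sum_C0 s : inC0 le (fan_sum s).
Proof.
  unfold fan_sum.
  assert (Hc : forall p, In p l -> inC0 le (deviation p)).
  { intros p i. apply C0_sub; auto; [apply Hl; auto|apply C0_indic; auto]. }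
  clear Hl nd. induction l as [|p l' IH]; simpl; [apply C0_zero; auto|].
  apply (C0_add Htree Hhaus (fscal (s p) (deviation p))
     (fun z => sumR (fun p => s p * deviation p z) l')).
  - apply C0_scal; auto. apply Hc; simpl; auto.
  - apply IH. intros; apply Hc; simpl; auto.
Qed.

Lemma dual_fan_sum phi s : dual_elem le N phi ->
  phi (fan_sum s) = sumR (fun p => s p * phi (deviation p)) l.
Proof.
  intros (add & scal & _). unfold fan_sum.
  assert (Hc : forall p, In p l -> inC0 le (deviation p)).
  { intros p i. apply C0_sub; auto; [apply Hl; auto|apply C0_indic; auto]. }
  assert (Hs : forall l', incl l' l -> inC0 le (fun z => sumR (fun p => s p * deviation p z) l')
     /\ phi (fun z => sumR (fun p => s p * deviation p z) l') = sumR (fun p => s p * phi (deviation p)) l').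
  { induction l' as [|p l' IH]; intros inc; simpl.
    - split; [apply C0_zero; auto|].
      replace (fun _ : T => 0) with (fscal 0 (fun _ : T => 0)).
      + rewrite scal; [lra|apply C0_zero; auto].
      + apply functional_extensionality; intros; unfold fscal; lra.
    - destruct IH as [IHc IHp]; [intros x i; apply inc; simpl; auto|].
      assert (inC0 le (fscal (s p) (deviation p))).
      { apply C0_scal; auto. apply Hc, inc; simpl; auto. }
      split.
      + apply (C0_add Htree Hhaus (fscal (s p) (deviation p)) _); auto.
      + rewrite <- IHp, <- scal; [|apply Hc, inc; simpl; auto].
        apply (add (fscal (s p) (deviation p)) _); auto. }
  apply Hs, incl_refl.
Qed.

Lemma norm_sum_le M l' : incl l' l -> (forall p, In p l -> N (snd p) <= M) ->
  inC0 le (fun z => sumR (fun p => snd p z) l') /\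
  N (fun z => sumR (fun p => snd p z) l') <= INR (length l') * M.
Proof.
  intros inc HM. destruct HN as ((_ & _ & scal & tri) & _).
  induction l' as [|p l' IH]; simpl.
  - split; [apply C0_zero; auto|].
    replace (fun _ : T => 0) with (fscal 0 (fun _ : T => 0)).
    + rewrite scal; [|apply C0_zero; auto]. rewrite Rabs_R0. lra.
    + apply functional_extensionality; intros; unfold fscal; lra.
  - destruct IH as [IHc IHp]; [intros x i; apply inc; simpl; auto|].
    assert (i : In p l) by (apply inc; simpl; auto).
    assert (Hc : inC0 le (snd p)) by (apply Hl; auto).
    split.
    + apply (C0_add Htree Hhaus (snd p) _); auto.
    + change (match length l' with O => 1 | S _ => INR (length l') + 1 end) with (INR (S (length l'))).
      rewrite S_INR. specialize (tri (snd p) _ Hc IHc). specialize (HM p i).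
      unfold fadd in tri at 1. lra.
Qed.

End Fan.

Lemma no_bad_point (HK : kadec le N) rho :
  (forall t, (forall h, extends_one t h -> rho t <= N h) /\
     (forall d, 0 < d -> exists h, extends_one t h /\ N h < rho t + d)) ->
  forall t, ~ bad_point le rho t.
Proof.
  intros Hrho t bad.
  destruct (equivalent_norm_bounds Htree Hhaus N HN) as (c & C & c0 & C0 & lower & upper).
  set (e := indic (le := le) t).
  assert (He : inC0 le e) by (apply C0_indic; auto).
  assert (Hte : extends_one t e) by apply extends_one_indic.
  assert (rpos : c <= rho t).
  { apply Rnot_lt_le. intros h. destruct (proj2 (Hrho t) (c - rho t)) as (g & Hg & Ng); [lra|].
    specialize (lower g t (proj1 Hg)). destruct Hg as (_ & g1 & _).
    rewrite g1, Rabs_R1 in lower; [lra|apply le_refl; auto]. }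
  (* A function of norm at most [rho t + 1] has absolute values at most [(rho t + 1) / c]; the added
     1 bounds the indicator. *)
  set (B := (rho t + 1) / c + 1).
  assert (B0 : 0 <= B).
  { unfold B. assert (0 < (rho t + 1) / c) by (apply Rdiv_lt_0_compat; lra). lra. }
  assert (family : forall d, 0 < d <= 1 -> forall k, exists l : list (T * (T -> R)),
     length l = k /\ NoDup (map fst l) /\ forall p, In p l ->
       (succ_of le t (fst p) /\ extends_one (fst p) (snd p) /\
         forall z, Rabs (snd p z - indic (le := le) t z) <= B) /\ N (snd p) <= rho t + d).
  { intros d d0. induction k as [|k (l & len & nd & Hl)].
    - exists []. simpl. repeat split; auto using NoDup_nil; tauto.
    - assert (ex : exists u, succ_of le t u /\ ~ In u (map fst l) /\ rho u < rho t + d).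
      { apply NNPP. intros no. apply bad. exists (map fst l). split.
        - intros u i. apply in_map_iff in i. destruct i as (p & <- & i). apply Hl; auto.
        - exists (rho t + d). split; [lra|]. intros u su ni. apply Rnot_lt_le. intros h. eauto. }
      destruct ex as (u & su & ni & ru).
      destruct (proj2 (Hrho u) (rho t + d - rho u)) as (h & Hh & Nh); [lra|].
      exists ((u, h) :: l). simpl. split; [auto|]. split; [constructor; auto|].
      intros p [<-|i]; auto. simpl. split; [split; [auto|split; [auto|]]|lra].
      intros z. replace (h z - indic t z) with (h z + - indic (le := le) t z) by lra.
      eapply Rle_trans; [apply Rabs_triang|]. unfold B. rewrite Rabs_Ropp.
      apply Rplus_le_compat.
      + apply (Rmult_le_reg_l c); auto.
        replace (c * ((rho t + 1) / c)) with (rho t + 1) by (field; lra).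
        eapply Rle_trans; [apply lower; apply Hh|]. lra.
      + destruct (classic (z ≼ t)).
        * rewrite indic_in, Rabs_R1; auto; lra.
        * rewrite indic_out, Rabs_R0; auto; lra. }
  (* [k + 1] times the indicator is the sum of the [k + 1] near-minimisers minus their fan sum,
     whose norm is at most [C * B] for every [k]; after division by [k + 1] its share is below
     [d / 2]. *)
  assert (Ne : N e = rho t).
  { apply Rle_antisym; [|apply Hrho; auto].
    apply le_epsilon. intros d d0. set (d' := Rmin (d/2) 1).
    assert (Hd' : 0 < d' <= 1).
    { split; [apply Rmin_glb_lt; lra|apply Rmin_r]. }
    destruct (INR_unbounded (2 * (C * B) / d)) as (k & Hk).
    destruct (family d' Hd' (S k)) as (l & len & nd & Hl).
    assert (Hl' := fun p i => proj1 (Hl p i)).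
    destruct (norm_sum_le t B l Hl' (rho t + d') l) as (Sc & SN);
      [apply incl_refl|intros; apply Hl; auto|].
    set (F := fan_sum t l (fun _ => 1)).
    assert (Fc : inC0 le F) by (apply (fan_sum_C0 t B l Hl')).
    assert (FB : N F <= C * B).
    { apply upper; auto. intros z. apply (fan_sum_bound t B B0 l nd Hl').
      intros; rewrite Rabs_R1; lra. }
    assert (HNn := HN). destruct HNn as ((_ & _ & scal & tri) & _).
    assert (E : fscal (INR (S k)) e = fadd (fun z => sumR (fun p => snd p z) l) (fscal (-1) F)).
    { apply functional_extensionality. intros z. unfold fscal, fadd, F, fan_sum, deviation, fsub.
      rewrite sumR_scal, <- len. fold e. clear. induction l as [|p l IH]; [simpl; lra|].
      change (length (p :: l)) with (S (length l)). rewrite S_INR. simpl. lra. }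
    assert (Ht := tri _ _ Sc (C0_scal Htree Hhaus (-1) F Fc)). rewrite <- E in Ht.
    rewrite !scal in Ht; auto. rewrite len in SN.
    rewrite (Rabs_left (-1)), (Rabs_right (INR (S k))) in Ht; [|apply Rle_ge, pos_INR|lra].
    rewrite S_INR in *. pose proof (pos_INR k). set (q := INR k) in *.
    assert (2 * (C * B) < q * d).
    { apply (Rmult_lt_reg_r (/ d)); [apply Rinv_0_lt_compat; auto|].
      replace (q * d * / d) with q by (field; lra). exact Hk. }
    assert (d' <= d / 2) by apply Rmin_l.
    apply (Rmult_le_reg_l (q + 1)); [lra|]. nra. }
  set (nu := rho t) in *.
  (* A normalised near-minimiser takes the value [/ m] at [u], with [m <= nu + 1], while [e1]
     vanishes there; so its distance from [e1] is at least [r]. *)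
  set (r := c / (nu + 1)).
  assert (r0 : 0 < r) by (apply Rdiv_lt_0_compat; lra).
  assert (HNn := HN). destruct HNn as ((pos & _ & scal & tri) & _).
  set (e1 := fscal (/ nu) e).
  assert (He1 : inC0 le e1) by (apply C0_scal; auto).
  assert (N1 : N e1 = 1).
  { unfold e1. rewrite scal, Ne, Rabs_right; auto; [field; lra|].
    apply Rle_ge, Rlt_le, Rinv_0_lt_compat. lra. }
  destruct (HK (fun f => N (fsub f e1) < r)) as [_ toweak].
  destruct toweak as (V & Vop & HV).
  { exists (fun f => N (fsub f e1) < r). split; [|tauto].
    intros f Hf Uf. exists (r - N (fsub f e1)). split; [lra|].
    intros g Hg Ng. replace (fsub g e1) with (fadd (fsub g f) (fsub f e1)).
    - eapply Rle_lt_trans; [apply tri; apply C0_sub; auto|]. lra.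
    - apply functional_extensionality. intros z. unfold fadd, fsub. lra. }
  assert (Ve : V e1).
  { apply HV; auto. replace (fsub e1 e1) with (fscal 0 e1).
    - rewrite scal, Rabs_R0; auto. lra.
    - apply functional_extensionality. intros z. unfold fscal, fsub. lra. }
  destruct (Vop e1 He1 Ve) as (Phi & d & HPhi & d0 & Hd).
  assert (bounds : exists K, 0 <= K /\ forall phi, In phi Phi -> Rabs (phi e) <= K).
  { clear. induction Phi as [|phi Phi (K & K0 & HK)]; [exists 0; simpl; split; [lra|tauto]|].
    exists (Rmax K (Rabs (phi e))). split; [eapply Rle_trans; [|apply Rmax_l]; auto|].
    intros x [<-|i]; [apply Rmax_r|]. eapply Rle_trans; [|apply Rmax_l]; auto. }
  destruct bounds as (K & K0 & HK').
  (* With suitable signs the sum of the absolute values of [phi] on the deviations is [phi] of one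
     fan sum, hence bounded independently of the fan. A long fan therefore contains a deviation on
     which all of [Phi] is small. *)
  assert (dual_bounds : exists D, 0 <= D /\ forall l, NoDup (map fst l) ->
     (forall p, In p l -> succ_of le t (fst p) /\ extends_one (fst p) (snd p) /\
       forall z, Rabs (snd p z - indic (le := le) t z) <= B) ->
     sumR (fun p => sumR (fun phi => Rabs (phi (deviation t p))) Phi) l <= D).
  { clear Hd HK'. induction Phi as [|phi Phi' IH].
    - exists 0. split; [lra|]. intros l _ _. simpl. rewrite (sumR_ext _ (fun _ => 0 * 0)); [|intros; lra].
      rewrite sumR_scal. lra.
    - destruct IH as (D & D0 & HD); [intros; apply HPhi; simpl; auto|].
      assert (dphi : dual_elem le N phi) by (apply HPhi; simpl; auto).
      assert (dphi' := dphi). destruct dphi' as (_ & _ & L & HL).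
      exists (Rabs L * (C * B) + D). split.
      { pose proof (Rmult_le_pos _ _ (Rabs_pos L) (Rmult_le_pos _ _ (Rlt_le _ _ C0) B0)). lra. }
      intros l nd Hl. simpl. rewrite sumR_plus. apply Rplus_le_compat; auto.
      set (s := fun p => if Rle_lt_dec 0 (phi (deviation t p)) then 1 else -1).
      assert (Hs : forall p, Rabs (s p) <= 1).
      { intros p. unfold s. destruct (Rle_lt_dec 0 (phi (deviation t p))).
        - rewrite Rabs_R1. lra.
        - rewrite Rabs_left; lra. }
      assert (Fc := fan_sum_C0 t B l Hl s).
      replace (sumR (fun p => Rabs (phi (deviation t p))) l) with (phi (fan_sum t l s)).
      + eapply Rle_trans; [apply Rle_abs|]. eapply Rle_trans; [apply HL; auto|].
        apply Rle_trans with (Rabs L * N (fan_sum t l s)).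
        * apply Rmult_le_compat_r; [auto|apply Rle_abs].
        * apply Rmult_le_compat_l; [apply Rabs_pos|].
          apply upper; auto. intros z. apply (fan_sum_bound t B B0 l nd Hl); auto.
      + rewrite (dual_fan_sum t B l Hl); auto. apply sumR_ext. intros p _. unfold s.
        destruct (Rle_lt_dec 0 (phi (deviation t p))).
        * rewrite Rabs_right; lra.
        * rewrite Rabs_left; lra. }
  destruct dual_bounds as (D & D0 & HD).
  (* [phi] of the difference of [h1] and [e1] splits into the deviation part divided by [m], below
     [kappa / nu = d / 2], and [phi e] times [/ m - / nu], which [dl] keeps within [d / 2]. *)
  set (kappa := d * nu / 2). assert (k0 : 0 < kappa) by (unfold kappa; nra).
  set (dl := Rmin 1 (d * (nu * nu) / (2 * (K + 1)))).
  assert (Hdl : 0 < dl <= 1).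
  { split; [|apply Rmin_l]. apply Rmin_glb_lt; [lra|].
    apply Rdiv_lt_0_compat; [repeat apply Rmult_lt_0_compat|]; lra. }
  destruct (INR_unbounded (D / kappa)) as (k & Hk).
  destruct (family dl Hdl k) as (l & len & nd & Hl).
  assert (Hl' := fun p i => proj1 (Hl p i)).
  assert (good : exists p, In p l /\ sumR (fun phi => Rabs (phi (deviation t p))) Phi < kappa).
  { apply NNPP. intros no.
    assert (INR k * kappa <= D).
    { eapply Rle_trans; [|apply (HD l nd Hl')]. rewrite <- len.
      clear - no. induction l as [|p l IH]; [simpl; lra|].
      change (length (p :: l)) with (S (length l)). rewrite S_INR. simpl.
      assert (kappa <= sumR (fun phi => Rabs (phi (deviation t p))) Phi).
      { apply Rnot_lt_le. intros h. apply no. exists p; simpl; auto. }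
      assert (INR (length l) * kappa <=
        sumR (fun p => sumR (fun phi => Rabs (phi (deviation t p))) Phi) l); [|lra].
      apply IH. intros (q & i & hq). apply no. exists q; simpl; auto. }
    assert (D < INR k * kappa); [|lra].
    apply (Rmult_lt_reg_r (/ kappa)); [apply Rinv_0_lt_compat; auto|].
    replace (INR k * kappa * / kappa) with (INR k) by (field; lra). exact Hk. }
  destruct good as ((u & h) & i & small).
  destruct (Hl _ i) as ((su & Hh & _) & Nh). simpl in su, Hh, Nh.
  destruct (succ_lt Htree _ _ su) as [tu _].
  assert (Hc : inC0 le h) by apply Hh.
  assert (Nh' : nu <= N h) by (apply Hrho; apply (extends_one_mono t u); auto).
  set (m := N h) in *.
  set (h1 := fscal (/ m) h).
  assert (Hh1 : inC0 le h1) by (apply C0_scal; auto).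
  assert (m0 : 0 < m) by lra.
  assert (im : 0 < / m) by (apply Rinv_0_lt_compat; auto).
  assert (inu : 0 < / nu) by (apply Rinv_0_lt_compat; lra).
  assert (Nh1 : N h1 = 1).
  { unfold h1. rewrite scal, Rabs_right; auto; [fold m; field; lra|lra]. }
  assert (Vh : V h1).
  { apply Hd; auto. intros phi ip.
    assert (dphi := HPhi phi ip).
    assert (E : phi h = phi e + phi (deviation t (u, h))).
    { unfold deviation. simpl. fold e. rewrite (dual_sub phi); auto. lra. }
    destruct dphi as (_ & ps & _). unfold h1, e1. rewrite !ps; auto. rewrite E.
    assert (a1 : Rabs (phi (deviation t (u, h))) < kappa).
    { eapply Rle_lt_trans; [|apply small].
      clear - ip. induction Phi as [|x P IH]; [contradiction|]. simpl. destruct ip as [->|ip].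
      - assert (0 <= sumR (fun phi => Rabs (phi (deviation t (u, h)))) P); [|lra].
        apply sumR_nonneg. intros; apply Rabs_pos.
      - pose proof (Rabs_pos (x (deviation t (u, h)))). specialize (IH ip). lra. }
    assert (a2 := HK' phi ip).
    set (x := phi e) in *. set (y := phi (deviation t (u, h))) in *.
    replace (/ m * (x + y) - / nu * x) with (y * / m + x * ((nu - m) * (/ m * / nu))) by (field; lra).
    eapply Rle_lt_trans; [apply Rabs_triang|]. rewrite !Rabs_mult.
    rewrite (Rabs_right (/ m)), (Rabs_right (/ nu)); try lra.
    assert (b1 : / m <= / nu) by (apply Rinv_le_contravar; lra).
    assert (b2 : Rabs (nu - m) <= dl) by (rewrite Rabs_left1; lra).
    assert (b3 : Rabs y * / m < d / 2).
    { apply Rle_lt_trans with (Rabs y * / nu).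
      - apply Rmult_le_compat_l; auto. apply Rabs_pos.
      - replace (d / 2) with (kappa * / nu) by (unfold kappa; field; lra).
        apply Rmult_lt_compat_r; auto. }
    assert (b4 : Rabs x * (Rabs (nu - m) * (/ m * / nu)) <= d / 2).
    { apply Rle_trans with ((K + 1) * (dl * (/ nu * / nu))).
      - apply Rmult_le_compat; [apply Rabs_pos| |lra|].
        + apply Rmult_le_pos; [apply Rabs_pos|nra].
        + apply Rmult_le_compat; [apply Rabs_pos|nra|auto|nra].
      - apply Rle_trans with ((K + 1) * ((d * (nu * nu) / (2 * (K + 1))) * (/ nu * / nu))).
        + apply Rmult_le_compat_l; [lra|]. apply Rmult_le_compat_r; [nra|]. apply Rmin_r.
        + right. field. lra. }
    lra. }
  apply HV in Vh; auto. simpl in Vh.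
  assert (L : c * / m <= N (fsub h1 e1)).
  { replace (/ m) with (Rabs (fsub h1 e1 u)); [apply lower; apply C0_sub; auto|].
    unfold fsub, h1, e1, fscal, e. destruct Hh as (_ & hu & _).
    rewrite hu, indic_out; [|apply (succ_not_le_pred Htree); auto|apply le_refl; auto].
    replace (/ m * 1 - / nu * 0) with (/ m) by lra. apply Rabs_right. lra. }
  assert (r <= c * / m); [|lra].
  unfold r, Rdiv. apply Rmult_le_compat_l; [lra|]. apply Rinv_le_contravar; lra.
Qed.

Lemma increasing_of_kadec : kadec le N ->
  exists rho : T -> R, tree_increasing le rho /\ forall t, ~ bad_point le rho t.
Proof.
  intros HK. destruct inf_norm_exists as (rho & Hrho). exists rho. split.
  - intros s t st. apply le_epsilon. intros d d0.
    destruct (proj2 (Hrho t) d d0) as (h & Hh & Nh).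
    assert (rho s <= N h); [|lra]. apply Hrho. apply (extends_one_mono s t); auto.
  - apply (no_bad_point HK); auto.
Qed.

End Necessity.

(** * Essential successors *)

(** An enumeration of the rationals: a difference of two naturals over a positive natural, the three
    being decoded from one index. *)
Lemma dense_sequence : exists q : nat -> R, forall a b, a < b -> exists k, a < q k < b.
Proof.
  exists (fun k => let (xy, n) := Cantor.of_nat k in let (x, y) := Cantor.of_nat xy in
                   (INR x - INR y) / (INR n + 1)).
  intros a b ab. destruct (INR_unbounded (/ (b - a))) as (n & Hn).
  destruct (archimed (a * (INR n + 1))) as [h1 h2]. set (p := up (a * (INR n + 1))) in *.
  exists (Cantor.to_nat (Cantor.to_nat (Z.to_nat p, Z.to_nat (- p)), n)).
  rewrite !Cantor.cancel_of_to.
  replace (INR (Z.to_nat p) - INR (Z.to_nat (- p))) with (IZR p).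
  2:{ rewrite !INR_IZR_INZ, <- minus_IZR. f_equal. lia. }
  pose proof (pos_INR n).
  assert (1 < (b - a) * (INR n + 1)).
  { assert (1 < (b - a) * INR n); [|nra]. replace 1 with ((b - a) * / (b - a)) by (field; lra).
    apply Rmult_lt_compat_l; lra. }
  split; apply (Rmult_lt_reg_r (INR n + 1)); try lra;
    replace (IZR p / (INR n + 1) * (INR n + 1)) with (IZR p) by (field; lra); lra.
Qed.

Lemma NoDup_same {X} (l : list X) : exists l', NoDup l' /\ forall x, In x l' <-> In x l.
Proof.
  induction l as [|a l (l' & nd & H)]; [exists []; split; [constructor|tauto]|].
  destruct (classic (In a l)) as [i|i].
  - exists l'. split; auto. intros x. rewrite H. simpl. intuition (subst; auto).
  - exists (a :: l'). split; [constructor; auto; rewrite H; auto|].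
    intros x. simpl. rewrite H. tauto.
Qed.

Section Essential.
Context {T : Type} {le : T -> T -> Prop} (Htree : is_tree le) (Hhaus : hausdorff_tree le).
Local Notation "s ≼ t" := (le s t) (at level 70).

(** Crossing from [a] to a successor outside the finite list [F a] uses up the colour of [a]
    along every chain. *)
Definition branching (F : T -> list T) (col : T -> nat) : Prop :=
  (forall a u, In u (F a) -> succ_of le a u) /\ (forall a, NoDup (F a)) /\
  (forall a u a' u', succ_of le a u -> ~ In u (F a) -> u ≼ a' ->
     succ_of le a' u' -> ~ In u' (F a') -> col a <> col a').

(** The colour of [a] indexes a rational strictly between [rho a] and the values of [rho] on the
    successors outside [F a]. At a later crossing point [a'] the value [rho a'] already exceeds that
    rational and is below its own, so the colours differ. *)
Lemma branching_exists rho : tree_increasing le rho -> (forall t, ~ bad_point le rho t) ->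
  exists F col, branching F col.
Proof.
  intros inc good. destruct dense_sequence as (q & Hq).
  assert (H : forall a, exists p : list T * nat, (forall u, In u (fst p) -> succ_of le a u) /\
     NoDup (fst p) /\ rho a < q (snd p) /\
     forall u, succ_of le a u -> ~ In u (fst p) -> q (snd p) < rho u).
  { intros a. destruct (NNPP _ (good a)) as (F & HF & c & ac & Hc).
    destruct (NoDup_same F) as (F' & nd & HF'). destruct (Hq _ _ ac) as (k & k1 & k2).
    exists (F', k). simpl. split; [|split; [auto|split; [auto|]]].
    - intros u iu. apply HF, HF'; auto.
    - intros u su ni. apply Rlt_le_trans with c; auto. apply Hc; auto. rewrite <- HF'; auto. }
  set (P := fun a => epsilon (inhabits ([], 0%nat)) (fun p : list T * nat =>
     (forall u, In u (fst p) -> succ_of le a u) /\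
     NoDup (fst p) /\ rho a < q (snd p) /\
     forall u, succ_of le a u -> ~ In u (fst p) -> q (snd p) < rho u)).
  assert (HP := fun a => epsilon_spec (inhabits ([], 0%nat)) _ (H a)).
  exists (fun a => fst (P a)), (fun a => snd (P a)). split; [|split].
  - intros a. apply HP.
  - intros a. apply HP.
  - intros a u a' u' su ni ua' su' ni' e.
    destruct (HP a) as (_ & _ & _ & h1), (HP a') as (_ & _ & h2 & _).
    fold (P a) in h1. fold (P a') in h2. specialize (h1 u su ni). rewrite e in h1.
    assert (rho u <= rho a') by (apply inc; auto). lra.
Qed.

Context (F : T -> list T) (col : T -> nat) (HF : branching F col).

(** A bound on the sum bounds both the number of essential successors and the colour. *)
Definition level_of (a : T) : nat := length (F a) + col a.
Definition defect_of (f : T -> R) (a : T) : R := f a - sumR f (F a).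
Local Notation level := level_of.
Local Notation defect := defect_of.

(** Crossings below a common [y] lie on one chain, where no colour is used at two points; so each
    colour up to [c] contributes at most one [a]. *)
Lemma finite_crossings c y : exists l, forall a u,
  succ_of le a u -> ~ In u (F a) -> u ≼ y -> (level a <= c)%nat -> In a l.
Proof.
  destruct HF as (_ & _ & Hcol).
  assert (E : forall k, exists l, forall a u,
     succ_of le a u -> ~ In u (F a) -> u ≼ y -> (col a < k)%nat -> In a l).
  { induction k as [|k (l & Hl)]; [exists []; intros; lia|].
    destruct (classic (exists a u, succ_of le a u /\ ~ In u (F a) /\ u ≼ y /\ col a = k))
      as [(b & v & sv & nv & vy & cb)|no].
    - exists (b :: l). intros a u su nu uy ca.
      destruct (Nat.eq_dec (col a) k) as [e|ne]; [|right; apply (Hl a u); auto; lia].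
      left. destruct (classic (u = v)) as [->|nuv]; [eapply succ_pred_unique; eauto|].
      exfalso. destruct (le_chain Htree u v y uy vy) as [h|h].
      + apply (Hcol a u b v); auto; [|congruence]. apply (succ_pred b v u); auto.
      + apply (Hcol b v a u); auto; [|congruence]. apply (succ_pred a u v); auto.
    - exists l. intros a u su nu uy ca. apply (Hl a u); auto.
      assert (col a <> k) by (intros e; apply no; exists a, u; auto). lia. }
  destruct (E (S c)) as (l & Hl). exists l. intros a u su nu uy ca. apply (Hl a u); auto.
  unfold level_of in ca. lia.
Qed.

(** The third clause says that no branch of the finite tree [down X] leaves [(0,y]] inside [O], the
    fourth that no crossing of level at most [c] takes place inside [O]. *)
Definition nice_nbhd (f : T -> R) (X : list T) (c : nat) (eta : R) (y : T) (O : T -> Prop) : Prop :=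
  (forall z, O z -> z ≼ y) /\
  (forall z z', O z -> z ≼ z' -> z' ≼ y -> O z') /\
  (forall z x, O z -> In x X -> z ≼ x -> y ≼ x) /\
  (forall z a u, O z -> succ_of le a u -> ~ In u (F a) -> u ≼ y -> (level a <= c)%nat -> ~ z ≼ a) /\
  (forall z, O z -> Rabs (f z - f y) < eta).

Lemma nice_nbhd_exists f X c eta y : tree_continuous le f -> 0 < eta ->
  exists O, tree_open le O /\ O y /\ nice_nbhd f X c eta y O.
Proof.
  intros cont eta0.
  destruct (cont y eta eta0) as (U & Uop & Uy & HU).
  destruct (Uop y Uy) as (l & ly & lU).
  destruct (finite_crossings c y) as (A & HA).
  (* Removing the intervals below these points from (0,y] enforces the third and the fourth clause
     at once: a crossing point below [y] is strictly below it, so its interval omits [y]. *)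
  destruct (list_filter (fun x => ~ y ≼ x) (X ++ A)) as (Z & HZ).
  set (L := (true, y) :: map (fun x => (false, x)) Z ++ l).
  assert (neg : forall z x, basic le L z -> In x Z -> ~ z ≼ x).
  { intros z x Hz i. apply (Hz (false, x)). right. apply in_or_app. left.
    apply (in_map (fun x => (false, x))) in i. exact i. }
  exists (basic le L). split; [apply open_basic|].
  assert (Ly : basic le L y).
  { intros bt [<-|i]; [apply (le_refl Htree)|]. apply in_app_or in i. destruct i as [i|i]; [|exact (ly _ i)].
    apply in_map_iff in i. destruct i as (x & <- & i). apply HZ in i. apply i. }
  split; auto. repeat split.
  - intros z Hz. apply (Hz (true, y)). simpl; auto.
  - intros z z' Hz zz' z'y. apply (basic_convex Htree L z z' y); auto.
  - intros z x Hz i zx. apply NNPP. intros yx. apply (neg z x Hz); auto.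
    apply HZ. split; auto. apply in_or_app; auto.
  - intros z a u Hz su nu uy la. apply (neg z a Hz). apply HZ. split.
    + apply in_or_app. right. apply (HA a u); auto.
    + intros ya. apply (succ_not_le_pred Htree a u); auto. eapply le_tr; eauto.
  - intros z Hz. apply HU, lU. intros bt i. apply Hz. right. apply in_or_app; auto.
Qed.

Lemma nice_cover f X c eta : tree_continuous le f -> 0 < eta ->
  exists W, forall z, down (le := le) X z ->
    exists w O, In w W /\ down (le := le) X w /\ nice_nbhd f X c eta w O /\ O w /\ O z.
Proof.
  intros cont eta0.
  destruct (finite_centers Htree Hhaus X (fun y O => nice_nbhd f X c eta y O /\ O y)) as (W & HW).
  - intros y _. destruct (nice_nbhd_exists f X c eta y cont eta0) as (O & o & Oy & n). exists O; auto.
  - exists W. intros z dz. destruct (HW z dz) as (w & O & i & dw & (n & Ow) & Oz). exists w, O. auto.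
Qed.

(** If [u] were below some [x] of [X], the third clause at [m] would put [y] below [x] too, and then
    [u] would be the successor of [m] towards [y]. *)
Lemma branch_off_nbhd f X c eta y O m u : nice_nbhd f X c eta y O -> O m -> m <> y ->
  succ_of le m u -> ~ u ≼ y -> ~ down (le := le) X u.
Proof.
  intros (sub & _ & HX & _ & _) Om n su uy (x & i & ux).
  destruct (succ_lt Htree _ _ su) as [mu _].
  assert (mx : m ≼ x) by (eapply le_tr; eauto).
  assert (yx := HX m x Om i mx).
  destruct (succ_toward Htree m y) as (v & sv & vy); auto.
  apply uy. rewrite (succ_eq_of_bound Htree m u v x); auto. eapply le_tr; eauto.
Qed.

Lemma sum_one_large (v : T -> R) (l : list T) (u : T) (gamma : R) : NoDup l -> In u l ->
  0 <= gamma -> (forall x, In x l -> x <> u -> Rabs (v x) <= gamma) ->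
  Rabs (sumR v l - v u) <= INR (length l) * gamma.
Proof.
  intros nd i g0 H. apply in_split in i. destruct i as (l1 & l2 & ->).
  rewrite sumR_app. simpl.
  replace (sumR v l1 + (v u + sumR v l2) - v u) with (sumR v (l1 ++ l2)) by (rewrite sumR_app; lra).
  eapply Rle_trans; [apply sumR_Rabs|]. eapply Rle_trans; [apply sumR_bound with (M := gamma)|].
  - intros x ix. apply H; [apply in_or_app; simpl; apply in_app_or in ix; tauto|].
    intros ->. apply NoDup_remove_2 in nd. auto.
  - apply Rmult_le_compat_r; auto. apply le_INR. rewrite !length_app. simpl. lia.
Qed.

(** Only centres of the covering neighbourhoods can have a large defect at these levels. At any
    other [a] the successor towards the centre is essential, for want of a crossing, and [f] hardly
    changes on the way to it; the other essential successors lie off [down X]. *)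
Lemma finite_large_defects f c eta : inC0 le f -> 0 < eta ->
  exists W, forall a, (level a <= c)%nat -> eta <= Rabs (defect f a) -> In a W.
Proof.
  intros Hf eta0. destruct HF as (Hs & Hnd & _). pose proof (pos_INR c) as c0.
  (* [a] and its at most [c] essential successors, at [th] each, contribute at most [eta / 2]. *)
  set (th := eta / (2 * (INR c + 1))).
  assert (th0 : 0 < th) by (apply Rdiv_lt_0_compat; lra).
  assert (thc : (INR c + 1) * th = eta / 2) by (unfold th; field; lra).
  destruct (C0_cover Htree f th Hf th0) as (X & HX).
  destruct (nice_cover f X c (eta/8) (proj1 Hf)) as (W & HW); [lra|].
  exists W. intros a la big.
  assert (len : INR (length (F a)) <= INR c) by (apply le_INR; unfold level_of in la; lia).
  assert (da : down (le := le) X a).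
  { apply NNPP. intros nd.
    assert (small : forall u, a ≼ u -> Rabs (f u) < th).
    { intros u au. apply Rnot_le_lt. intros h. apply nd. apply (down_le Htree X a u); auto. }
    assert (h1 := small a (le_refl Htree a)).
    assert (h2 : Rabs (sumR f (F a)) <= INR (length (F a)) * th).
    { eapply Rle_trans; [apply sumR_Rabs|]. apply sumR_bound. intros u i.
      apply Rlt_le, small. apply (succ_lt Htree a u); auto. }
    unfold defect_of in big. unfold Rminus in big.
    pose proof (Rabs_triang (f a) (- sumR f (F a))) as h3. rewrite Rabs_Ropp in h3.
    assert (INR (length (F a)) * th <= INR c * th) by (apply Rmult_le_compat_r; lra). lra. }
  destruct (HW a da) as (w & O & iw & _ & n & Ow & Oa).
  assert (n' := n). destruct n' as (sub & conv & HXO & cross & osc).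
  destruct (classic (a = w)) as [->|naw]; auto. exfalso.
  destruct (succ_toward Htree a w) as (u & su & uw); auto.
  destruct (succ_lt Htree a u su) as [au _].
  assert (iu : In u (F a)).
  { apply NNPP. intros ni. apply (cross a a u); auto. apply (le_refl Htree). }
  assert (Ou : O u) by (apply (conv a u); auto).
  assert (h := sum_one_large f (F a) u th (Hnd a) iu (Rlt_le _ _ th0)).
  assert (h' : Rabs (sumR f (F a) - f u) <= INR (length (F a)) * th).
  { apply h. intros x ix nx. apply Rlt_le, Rnot_le_lt. intros hx.
    apply (branch_off_nbhd f X c (eta/8) w O a x n Oa naw (Hs a x ix)).
    - intros xw. apply nx. apply (succ_eq_of_bound Htree a x u w); auto.
    - apply HX; auto. }
  assert (o1 := osc a Oa). assert (o2 := osc u Ou).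
  assert (INR (length (F a)) * th <= INR c * th) by (apply Rmult_le_compat_r; lra).
  unfold defect_of in big.
  replace (f a - sumR f (F a)) with ((f a - f w) + (- (f u - f w) + - (sumR f (F a) - f u))) in big by lra.
  pose proof (Rabs_triang (f a - f w) (- (f u - f w) + - (sumR f (F a) - f u))) as t1.
  pose proof (Rabs_triang (- (f u - f w)) (- (sumR f (F a) - f u))) as t2.
  rewrite !Rabs_Ropp in t2. lra.
Qed.

Definition antichain (l : list T) : Prop := forall r r', In r l -> In r' l -> r ≼ r' -> r = r'.

(** Assign to each member a point of [X] above it. Two members below the same point are comparable,
    hence equal, so the assignment is injective. *)
Lemma antichain_length X l : NoDup l -> antichain l ->
  (forall r, In r l -> down (le := le) X r) -> (length l <= length X)%nat.
Proof.
  intros nd anti dn.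
  assert (E : exists l', NoDup l' /\ incl l' X /\ length l' = length l /\
     forall y, In y l' -> exists r, In r l /\ r ≼ y).
  { induction l as [|r l IH].
    - exists []. repeat split; auto using NoDup_nil. intros x []. intros y [].
    - inversion nd as [|? ? ni nd']; subst.
      destruct IH as (l' & nd'' & inc & len & H); auto.
      { intros a b ia ib. apply anti; simpl; auto. }
      { intros a ia. apply dn; simpl; auto. }
      destruct (dn r) as (x & ix & rx); [simpl; auto|].
      exists (x :: l'). repeat split.
      + constructor; auto. intros i. destruct (H x i) as (r' & ir' & r'x).
        assert (r = r').
        { destruct (le_chain Htree r r' x) as [h|h]; auto.
          - apply anti; simpl; auto.
          - symmetry. apply anti; simpl; auto. }
        subst. auto.
      + intros z [<-|i]; auto.
      + simpl. auto.
      + intros z [<-|i]; [exists r; simpl; auto|].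
        destruct (H z i) as (r' & i' & h). exists r'. simpl; auto. }
  destruct E as (l' & nd' & inc & len & _). rewrite <- len. apply NoDup_incl_length; auto.
Qed.

End Essential.

(** * Admissible pairs and transport *)

Section Admissible.
Context {T : Type} {le : T -> T -> Prop} (Htree : is_tree le) (Hhaus : hausdorff_tree le).
Context (F : T -> list T) (col : T -> nat) (HF : branching (le := le) F col).
Local Notation "s ≼ t" := (le s t) (at level 70).
Local Notation down := (down (le := le)).
Local Notation antichain := (antichain (le := le)).
Local Notation level := (level_of F col).
Local Notation defect := (defect_of F).

(** The order conditions make each point of [B] terminal: no other point of either list lies above
    it, so that it can be replaced by whatever is above it. *)
Definition admissible (A B : list T) : Prop :=
  NoDup A /\ NoDup B /\ antichain B /\ forall r a, In r B -> In a A -> ~ r ≼ a.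

Definition weight_of (f : T -> R) (A B : list T) : R :=
  sumR (fun a => Rabs (defect f a)) A + sumR (fun r => Rabs (f r)) B.
Local Notation weight := weight_of.

Lemma weight_app f A A' B B' :
  weight f (A ++ A') (B ++ B') = weight f A B + weight f A' B'.
Proof. unfold weight_of. rewrite !sumR_app. lra. Qed.

Lemma admissible_nil : admissible [] [].
Proof. repeat split; try apply NoDup_nil. - intros r r' []. - intros r a []. Qed.

Lemma admissible_incl A B A' B' : admissible A B -> NoDup A' -> NoDup B' ->
  incl A' A -> incl B' B -> admissible A' B'.
Proof.
  intros (_ & _ & anti & H) nA nR iA iR. split; [auto|split; [auto|split]].
  - intros r r' i i'. apply anti; auto.
  - intros r a i i'. apply H; auto.
Qed.

Lemma admissible_perm A B B' : Permutation B B' -> admissible A B -> admissible A B'.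
Proof.
  intros p adm. apply (admissible_incl A B); auto; try apply adm; [|apply incl_refl|].
  - apply (Permutation_NoDup p). apply adm.
  - intros x i. apply (Permutation_in x (Permutation_sym p)); auto.
Qed.

Lemma NoDup_app_intro {X} (l l' : list X) : NoDup l -> NoDup l' ->
  (forall x, In x l -> ~ In x l') -> NoDup (l ++ l').
Proof.
  induction l as [|a l IH]; simpl; auto. intros nd nd' H. inversion nd as [|? ? ni nd'']; subst.
  constructor; auto. intros i. apply in_app_or in i. destruct i as [i|i]; auto.
  apply (H a); auto.
Qed.

Lemma admissible_app A B A' B' : admissible A B -> admissible A' B' ->
  (forall x y, In x A \/ In x B -> In y A' \/ In y B' -> ~ x ≼ y /\ ~ y ≼ x) ->
  admissible (A ++ A') (B ++ B').
Proof.
  intros (nA & nR & anti & H) (nA' & nR' & anti' & H') inc. split; [|split; [|split]].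
  - apply NoDup_app_intro; auto. intros x i i'. destruct (inc x x) as [h _]; auto. apply h, (le_refl Htree).
  - apply NoDup_app_intro; auto. intros x i i'. destruct (inc x x) as [h _]; auto. apply h, (le_refl Htree).
  - intros r r' i i' l. apply in_app_or in i, i'.
    destruct i as [i|i], i' as [i'|i'].
    + apply anti; auto.
    + exfalso. destruct (inc r r'); auto.
    + exfalso. destruct (inc r' r); auto.
    + apply anti'; auto.
  - intros r a i i' l. apply in_app_or in i, i'.
    destruct i as [i|i], i' as [i'|i'].
    + apply (H r a); auto.
    + destruct (inc r a); auto.
    + destruct (inc a r); auto.
    + apply (H' r a); auto.
Qed.

(** A point above [r] is below no point of [A], since [r] is not, and anything in the rest of [B]
    comparable with it would be comparable with [r]. *)
Lemma admissible_replace A B A' B' r : admissible A (r :: B) -> admissible A' B' ->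
  (forall z, In z A' \/ In z B' -> r ≼ z) -> admissible (A' ++ A) (B' ++ B).
Proof.
  intros (nA & nR & anti & H) (nA' & nR' & anti' & H') above.
  inversion nR as [|? ? ni nR1]; subst.
  assert (low : forall q z, In q B -> r ≼ z -> ~ z ≼ q /\ ~ q ≼ z).
  { intros q z i rz. split; intros h.
    - apply ni. rewrite (anti r q); simpl; auto. eapply le_tr; eauto.
    - apply ni. destruct (le_chain Htree r q z) as [h'|h']; auto.
      + rewrite (anti r q); simpl; auto.
      + rewrite <- (anti q r); simpl; auto. }
  assert (up : forall a z, In a A -> r ≼ z -> ~ z ≼ a).
  { intros a z i rz h. apply (H r a); simpl; auto. eapply le_tr; eauto. }
  split; [|split; [|split]].
  - apply NoDup_app_intro; auto. intros x i i'. apply (up x x); auto. apply (le_refl Htree).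
  - apply NoDup_app_intro; auto. intros x i i'. destruct (low x x) as [h _]; auto. apply h, (le_refl Htree).
  - intros x y i i' l. apply in_app_or in i, i'.
    destruct i as [i|i], i' as [i'|i'].
    + apply anti'; auto.
    + exfalso. destruct (low y x); auto.
    + exfalso. destruct (low x y); auto.
    + apply anti; simpl; auto.
  - intros x a i i' l. apply in_app_or in i, i'.
    destruct i as [i|i], i' as [i'|i'].
    + apply (H' x a); auto.
    + apply (up a x); auto.
    + destruct (low x a); auto.
    + apply (H x a); simpl; auto.
Qed.

(** * Redistribution of large values of [f] over higher points *)

Section Transport.
Context (f : T -> R) (Hf : inC0 le f) (eps : R) (eps0 : 0 < eps).

Definition reach (x : T) (v : R) : Prop := exists A B, admissible A B /\
  (forall z, In z A \/ In z B -> x ≼ z) /\ (forall r, In r B -> Rabs (f r) < eps) /\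
  v <= weight f A B.

Lemma reach_mono x y (v v' : R) : x ≼ y -> v' <= v -> reach y v -> reach x v'.
Proof.
  intros xy vv (A & B & adm & ab & sm & w). exists A, B. split; auto. split; [|split; auto; lra].
  intros z i. eapply le_tr; eauto.
Qed.

Lemma reach_small x : Rabs (f x) < eps -> reach x (Rabs (f x)).
Proof.
  intros h. exists [], [x]. split; [|split; [|split]].
  - split; [apply NoDup_nil|split; [constructor; auto using NoDup_nil|split]].
    + intros r r' [<-|[]] [<-|[]]; auto.
    + intros r a _ [].
  - intros z [[]|[<-|[]]]. apply (le_refl Htree).
  - intros r [<-|[]]; auto.
  - unfold weight_of. simpl. lra.
Qed.

Lemma reach_list a (v : T -> R) l : NoDup l -> (forall u, In u l -> succ_of le a u) ->
  (forall u, In u l -> reach u (v u)) ->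
  exists A B, admissible A B /\ (forall z, In z A \/ In z B -> exists u, In u l /\ u ≼ z) /\
    (forall r, In r B -> Rabs (f r) < eps) /\ sumR v l <= weight f A B.
Proof.
  induction l as [|u l IH]; intros nd su H.
  - exists [], []. split; [apply admissible_nil|]. split; [|split].
    + intros z [[]|[]].
    + intros r [].
    + unfold weight_of; simpl; lra.
  - inversion nd as [|? ? ni nd']; subst.
    destruct IH as (A & B & adm & ab & sm & w); auto.
    { intros x i; apply su; simpl; auto. }
    { intros x i; apply H; simpl; auto. }
    destruct (H u (or_introl eq_refl)) as (A' & B' & adm' & ab' & sm' & w').
    exists (A' ++ A), (B' ++ B). split; [|split; [|split]].
    + apply admissible_app; auto. intros x y ix iy.
      destruct (ab y iy) as (u' & iu' & u'y). assert (ux := ab' x ix).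
      assert (su' : succ_of le a u') by (apply su; simpl; auto).
      assert (suu : succ_of le a u) by (apply su; simpl; auto).
      split; intros h; apply ni.
      * rewrite (succ_eq_of_bound Htree a u u' y); auto. eapply le_tr; eauto.
      * rewrite (succ_eq_of_bound Htree a u u' x); auto. eapply le_tr; eauto.
    + intros z i. rewrite !in_app_iff in i.
      assert (In z A' \/ In z B' \/ In z A \/ In z B) as [i'|[i'|i']] by tauto.
      * exists u. simpl; auto.
      * exists u. simpl; auto.
      * destruct (ab z i') as (u' & iu' & h). exists u'; simpl; auto.
    + intros r i. apply in_app_or in i. destruct i; auto.
    + rewrite weight_app. simpl. lra.
Qed.

(** Adding [a] to [A] contributes its defect, and the defect together with the values on the
    essential successors dominates [f a]. The pairs that serve different successors are incomparable
    and can be united. *)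
Lemma reach_step a (err : T -> R) :
  (forall u, In u (F a) -> reach u (Rabs (f u) - err u)) ->
  reach a (Rabs (f a) - sumR err (F a)).
Proof.
  intros H. destruct HF as (Hs & Hnd & _).
  destruct (reach_list a (fun u => Rabs (f u) - err u) (F a) (Hnd a) (Hs a) H)
    as (A & B & (nA & nR & anti & HAR) & ab & sm & w).
  assert (na : forall z, In z A \/ In z B -> ~ z ≼ a).
  { intros z i h. destruct (ab z i) as (u & iu & uz).
    apply (succ_not_le_pred Htree a u); auto. eapply le_tr; eauto. }
  exists (a :: A), B. split; [|split; [|split; auto]].
  - split; [constructor; auto; intros i; apply (na a); auto; apply (le_refl Htree)|].
    split; [auto|split; [auto|]]. intros r b i [<-|i']; auto.
  - intros z i.
    assert (z = a \/ In z A \/ In z B) as [->|i'] by (simpl in i; intuition).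
    + apply (le_refl Htree).
    + destruct (ab z i') as (u & iu & uz). eapply le_tr; eauto. apply (succ_lt Htree); auto.
  - unfold weight_of in *. simpl.
    assert (E : Rabs (f a) <= Rabs (defect f a) + sumR (fun u => Rabs (f u)) (F a)).
    { replace (f a) with (defect f a + sumR f (F a)) by (unfold defect_of; lra).
      eapply Rle_trans; [apply Rabs_triang|]. apply Rplus_le_compat_l, sumR_Rabs. }
    assert (E' : sumR (fun u => Rabs (f u)) (F a) =
       sumR (fun u => Rabs (f u) - err u) (F a) + sumR err (F a)).
    { rewrite <- sumR_plus. apply sumR_ext. intros; lra. }
    lra.
Qed.

(** Backward induction along the chain ending at [x0]: at a successor step [reach_step] applies,
    since all the other branches are covered by the shorter list; at a limit step continuity of [f]
    suffices. *)
Lemma reach_all X : forall x, (forall y, x ≼ y -> eps <= Rabs (f y) -> down X y) ->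
  forall tau, 0 < tau -> reach x (Rabs (f x) - tau).
Proof.
  assert (HF' := HF). destruct HF' as (Hs & Hnd & _).
  induction X as [|x0 X IH]; intros x cov.
  { intros tau t0. apply (reach_mono x x (Rabs (f x))); [apply (le_refl Htree)|lra|].
    apply reach_small. apply Rnot_le_lt. intros h.
    destruct (cov x (le_refl Htree x) h) as (z & [] & _). }
  destruct (classic (x ≼ x0)) as [xx0|nx].
  2:{ apply IH. intros y xy h. destruct (cov y xy h) as (z & [<-|i] & yz).
      - exfalso. apply nx. eapply le_tr; eauto.
      - exists z; auto. }
  assert (side : forall u, x ≼ u -> ~ u ≼ x0 -> forall tau, 0 < tau -> reach u (Rabs (f u) - tau)).
  { intros u xu nu. apply IH. intros y uy h.
    destruct (cov y (le_tr Htree _ _ _ xu uy) h) as (z & [<-|i] & yz).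
    - exfalso. apply nu. eapply le_tr; eauto.
    - exists z; auto. }
  (* At most one essential successor of [a] lies on the chain to [x0], and it alone carries the loss
     [tau]. The others are side branches, whose loss may be chosen as [d / (n + 1)], at most [d]
     altogether. *)
  assert (step : forall a tau d u0, x ≼ a -> a ≼ x0 -> 0 < d -> 0 <= tau ->
     (forall u, In u (F a) -> u ≼ x0 -> u = u0 /\ reach u (Rabs (f u) - tau)) ->
     reach a (Rabs (f a) - (tau + d))).
  { intros a tau d u0 xa ax0 d0 t0 H.
    set (n := INR (length (F a))). assert (n0 : 0 <= n) by apply pos_INR.
    set (err := fun u => if excluded_middle_informative (u ≼ x0) then tau else d / (n + 1)).
    assert (dn : 0 < d / (n + 1)) by (apply Rdiv_lt_0_compat; lra).
    assert (dn' : n * (d / (n + 1)) <= d).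
    { replace d with ((n + 1) * (d / (n + 1))) at 2 by (field; lra). nra. }
    apply (reach_mono a a (Rabs (f a) - sumR err (F a))); [apply (le_refl Htree)| |].
    2:{ apply reach_step. intros u i. unfold err.
        destruct (excluded_middle_informative (u ≼ x0)) as [h|h].
        - apply H; auto.
        - apply side; auto. eapply le_tr; eauto. apply (succ_lt Htree a u); auto. }
    assert (sumR err (F a) <= tau + d); [|lra].
    destruct (classic (exists u, In u (F a) /\ u ≼ x0)) as [(u & iu & ux0)|no].
    - assert (eu : err u = tau).
      { unfold err. destruct (excluded_middle_informative (u ≼ x0)); tauto. }
      assert (h : Rabs (sumR err (F a) - err u) <= INR (length (F a)) * (d / (n + 1))).
      { apply sum_one_large; auto; [lra|]. intros y iy ny. unfold err.
        destruct (excluded_middle_informative (y ≼ x0)) as [h|h].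
        - exfalso. apply ny. destruct (H y iy h) as [-> _]. destruct (H u iu ux0) as [-> _]. auto.
        - rewrite Rabs_right; lra. }
      fold n in h. pose proof (Rle_abs (sumR err (F a) - err u)). lra.
    - assert (sumR err (F a) <= n * (d / (n + 1))); [|lra].
      apply sumR_bound. intros y iy. unfold err.
      destruct (excluded_middle_informative (y ≼ x0)) as [h|h]; [exfalso; eauto|lra]. }
  intros tau t0. apply NNPP. intros nr.
  (* The strict inequality [s < tau] leaves room: half of [tau - s] pays for one more step
     downwards, so the least point of [Z] on the chain must be [x]. *)
  set (Z := fun y => x ≼ y /\ exists s, 0 <= s < tau /\ reach y (Rabs (f y) - s)).
  destruct (le_least Htree x0 Z) as (y & (xy & s & hs & ry) & yx0 & ymin).
  { exists x0. split; [|apply (le_refl Htree)]. split; auto. exists (tau / 2). split; [lra|].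
    (* No successor of [x0] lies below [x0], so the loss starts from 0 and the last [x0] is a dummy
       value for [u0]. *)
    replace (tau / 2) with (0 + tau / 2) by lra. apply (step x0 0 (tau/2) x0); auto; try lra.
    - apply (le_refl Htree).
    - intros u i ux0. exfalso. apply (succ_not_le_pred Htree x0 u); auto. }
  destruct (classic (x = y)) as [<-|nxy].
  { apply nr. apply (reach_mono x x (Rabs (f x) - s)); auto; lra. }
  assert (below : forall a, x ≼ a -> a ≼ y -> a <> y -> ~ Z a).
  { intros a xa ay na Za. apply na, (le_anti Htree); auto. apply ymin; auto. eapply le_tr; eauto. }
  destruct (succ_or_limit Htree x y xy nxy) as [(a & xa & sa)|lim].
  - destruct (succ_lt Htree a y sa) as [ay na]. apply (below a); auto. split; auto.
    exists (s + (tau - s) / 2). split; [lra|].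
    apply (step a s ((tau - s) / 2) y); auto; try lra.
    + eapply le_tr; eauto.
    + intros u i ux0. assert (u = y) by (apply (succ_eq_of_bound Htree a u y x0); auto).
      subst. auto.
  - destruct (proj1 Hf y ((tau - s) / 2)) as (U & Uop & Uy & HU); [lra|].
    destruct (Uop y Uy) as (l & ly & lU).
    destruct (basic_limit Htree Hhaus l x y xy nxy lim ly) as (a & xa & ay & na & la).
    apply (below a); auto. split; auto. exists (s + (tau - s) / 2). split; [lra|].
    apply (reach_mono a y (Rabs (f y) - s)); auto.
    specialize (HU a (lU a la)).
    replace (f a) with ((f a - f y) + f y) by lra.
    pose proof (Rabs_triang (f a - f y) (f y)). lra.
Qed.

(** A neighbourhood lies below its centre [w], so a pair above [w] serves every [r] in it, up to the
    variation of [f] there. Finitely many centres then give one bound on sizes and levels. *)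
Lemma reach_uniform tau : 0 < tau -> exists m, forall r, eps <= Rabs (f r) ->
  exists A B, admissible A B /\ (forall z, In z A \/ In z B -> r ≼ z) /\
    (forall r, In r B -> Rabs (f r) < eps) /\ Rabs (f r) - tau <= weight f A B /\
    (length A <= m)%nat /\ (length B <= m)%nat /\ (forall a, In a A -> (level a <= m)%nat).
Proof.
  intros t0. destruct (C0_cover Htree f eps Hf eps0) as (X & HX).
  destruct (nice_cover Htree Hhaus F col HF f X 0 (tau / 2) (proj1 Hf)) as (W & HW); [lra|].
  destruct (uniform_nat (fun w m => exists A B, admissible A B /\
     (forall z, In z A \/ In z B -> w ≼ z) /\
     (forall r, In r B -> Rabs (f r) < eps) /\ Rabs (f w) - tau / 2 <= weight f A B /\
     (length A <= m)%nat /\ (length B <= m)%nat /\ (forall a, In a A -> (level a <= m)%nat)) W)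
    as (m & Hm).
  - intros w m m' mm (A & B & h1 & h2 & h3 & h4 & h5 & h6 & h7). exists A, B.
    split; [auto|]. split; [auto|]. split; [auto|]. split; [auto|].
    split; [lia|]. split; [lia|]. intros a i. specialize (h7 a i). lia.
  - intros w _. destruct (reach_all X w (fun y _ => HX y) (tau / 2)) as (A & B & h1 & h2 & h3 & h4); [lra|].
    destruct (uniform_nat (fun a m => (level a <= m)%nat) A) as (m & Hm); [intros; lia|eauto|].
    exists (max m (max (length A) (length B))), A, B.
    split; [auto|]. split; [auto|]. split; [auto|]. split; [auto|].
    split; [lia|]. split; [lia|]. intros a i. specialize (Hm a i). lia.
  - exists m. intros r hr. destruct (HW r (HX r hr)) as (w & O & iw & _ & n & _ & Or).
    destruct n as (sub & _ & _ & _ & osc).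
    destruct (Hm w iw) as (A & B & h1 & h2 & h3 & h4 & h5). exists A, B.
    split; [auto|]. split; [|split; [auto|split; [|auto]]].
    + intros z i. eapply le_tr; eauto.
    + specialize (osc r Or). replace (f r) with ((f r - f w) + f w) by lra.
      pose proof (Rabs_triang (f r - f w) (f w)). lra.
Qed.

(** The number [m] is fixed before the pair is given. The level bound and the sizes of a seminorm
    can thus be chosen first and a nearly optimal pair transported afterwards. *)
Lemma transport tau : 0 < tau -> exists m, forall Bb A Bs, admissible A (Bb ++ Bs) ->
  (forall r, In r Bb -> eps <= Rabs (f r)) -> (forall r, In r Bs -> Rabs (f r) < eps) ->
  exists A' B', admissible A' B' /\ (forall r, In r B' -> Rabs (f r) < eps) /\
    weight f A (Bb ++ Bs) - INR (length Bb) * tau <= weight f A' B' /\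
    (length A' <= length A + length Bb * m)%nat /\ (length B' <= length Bs + length Bb * m)%nat /\
    (forall a, In a A' -> In a A \/ (level a <= m)%nat).
Proof.
  intros t0. destruct (reach_uniform tau t0) as (m & Hm). exists m.
  induction Bb as [|r Bb IH]; intros A Bs adm big sm.
  - exists A, Bs. split; [auto|]. split; [auto|]. simpl. split; [lra|]. split; [lia|]. split; [lia|]. auto.
  - destruct (Hm r) as (A1 & B1 & h1 & h2 & h3 & h4 & h5 & h6 & h7); [apply big; simpl; auto|].
    assert (adm1 : admissible (A1 ++ A) (Bb ++ (B1 ++ Bs))).
    { apply (admissible_perm _ (B1 ++ (Bb ++ Bs))).
      - rewrite !app_assoc. apply Permutation_app_tail, Permutation_app_comm.
      - apply (admissible_replace A (Bb ++ Bs) A1 B1 r); auto. }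
    destruct (IH (A1 ++ A) (B1 ++ Bs)) as (A' & B' & g1 & g2 & g3 & g4 & g5 & g6); auto.
    { intros x i; apply big; simpl; auto. }
    { intros x i. apply in_app_or in i. destruct i; auto. }
    exists A', B'. split; [auto|]. split; [auto|]. split; [|split; [|split]].
    + assert (weight f (A1 ++ A) (Bb ++ B1 ++ Bs) = weight f A1 B1 + weight f A (Bb ++ Bs)).
      { unfold weight_of. rewrite !sumR_app. lra. }
      assert (weight f A ((r :: Bb) ++ Bs) = Rabs (f r) + weight f A (Bb ++ Bs)).
      { unfold weight_of. simpl. lra. }
      change (length (r :: Bb)) with (S (length Bb)). rewrite S_INR. lra.
    + rewrite length_app in g4. simpl. lia.
    + rewrite length_app in g5. simpl. lia.
    + intros a i. destruct (g6 a i) as [j|j]; auto. apply in_app_or in j. destruct j; auto.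
Qed.

End Transport.
End Admissible.

(** * Linked points and the gain of adding one point *)

Section Gain.
Context {T : Type} {le : T -> T -> Prop} (Htree : is_tree le) (Hhaus : hausdorff_tree le).
Context (F : T -> list T) (col : T -> nat) (HF : branching (le := le) F col).
Local Notation "s ≼ t" := (le s t) (at level 70).
Local Notation down := (down (le := le)).
Local Notation level := (level_of F col).
Local Notation defect := (defect_of F).
Local Notation admissible := (admissible (le := le)).
Local Notation weight := (weight_of F).

(** The clauses keep the stretch from [s] to just before [s'] free: a point of it can join [A], a
    successor branching off it can join [B], and at level at most [c] the successor towards [s'] is
    essential. *)
Definition linked (c : nat) (A B : list T) (s s' : T) : Prop :=
  s ≼ s' /\ (exists x, (In x A \/ In x B) /\ s' ≼ x) /\
  (forall x, In x A \/ In x B -> s ≼ x -> s' ≼ x) /\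
  (forall a u, succ_of le a u -> ~ In u (F a) -> (level a <= c)%nat -> s ≼ a -> ~ u ≼ s').

(** A member of [B] below [a] is either below [s], hence below the member [x] of the lists that lies
    above [s'], or between [s] and [a], where the link admits no member. *)
Lemma linked_no_point_below c A B s s' a r : admissible A B -> linked c A B s s' ->
  s ≼ a -> a ≼ s' -> a <> s' -> In r B -> ~ r ≼ a.
Proof.
  intros (_ & _ & anti & H) (ss & (x & ix & sx) & up & _) sa as' na i ra.
  destruct (le_chain Htree r s a ra sa) as [rs|sr].
  - destruct ix as [ix|ix].
    + apply (H r x i ix). apply (le_tr Htree r s x); auto. apply (le_tr Htree s s' x); auto.
    + assert (r = x).
      { apply anti; auto. apply (le_tr Htree r s x); auto. apply (le_tr Htree s s' x); auto. }
      subst. apply na, (le_anti Htree); auto. apply (le_tr Htree s' x a); auto.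
  - apply na, (le_anti Htree); auto. apply (le_tr Htree s' r a); auto.
Qed.

Lemma linked_extend_l c A B s s' a : admissible A B -> linked c A B s s' ->
  s ≼ a -> a ≼ s' -> a <> s' -> admissible (a :: A) B.
Proof.
  intros adm lk sa as' na. assert (adm' := adm). destruct adm' as (nA & nR & anti & H).
  split; [|split; [auto|split; [auto|]]].
  - constructor; auto. intros i. destruct lk as (_ & _ & up & _).
    apply na, (le_anti Htree); auto.
  - intros r b i [<-|i']; [|auto]. apply (linked_no_point_below c A B s s' a r); auto.
Qed.

Lemma linked_extend_r c A B s s' a z : admissible A B -> linked c A B s s' ->
  s ≼ a -> a ≼ s' -> a <> s' -> succ_of le a z -> ~ z ≼ s' -> admissible A (z :: B).
Proof.
  intros adm lk sa as' na sz nz. assert (adm' := adm). destruct adm' as (nA & nR & anti & H).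
  assert (lk' := lk). destruct lk' as (ss & _ & up & _).
  destruct (succ_lt Htree a z sz) as [az _].
  assert (out : forall x, In x A \/ In x B -> ~ z ≼ x).
  { intros x i zx. assert (s'x : s' ≼ x).
    { apply up; auto. apply (le_tr Htree s a x); auto. apply (le_tr Htree a z x); auto. }
    destruct (le_chain Htree z s' x zx s'x) as [h|h]; auto.
    apply na, (le_anti Htree); auto. apply (succ_pred a z s'); auto.
    intros e. apply nz. rewrite e. apply (le_refl Htree). }
  assert (low : forall r, In r B -> ~ r ≼ z).
  { intros r i rz. apply (linked_no_point_below c A B s s' a r adm lk sa as' na i).
    apply (succ_pred a z r); auto. intros ->. apply (out z); auto. }
  split; [auto|split; [|split]].
  - constructor; auto. intros i. apply (out z); auto. apply (le_refl Htree).
  - intros r r' [<-|i] [<-|i'] h; auto.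
    + exfalso. apply (out r'); auto.
    + exfalso. apply (low r); auto.
  - intros r b [<-|i] i'; [apply out; auto|apply H; auto].
Qed.

(** A link depends on the order alone, so the cover is taken for the zero function. The centre of a
    neighbourhood containing [t] is the upper end of a link from [t]. *)
Lemma linked_representatives c A B : exists W, forall t, down (A ++ B) t ->
  exists w, In w W /\ linked c A B t w.
Proof.
  assert (cont : tree_continuous le (fun _ => 0)) by apply (C0_zero Htree Hhaus).
  destruct (nice_cover Htree Hhaus F col HF (fun _ => 0) (A ++ B) c 1 cont) as (W & HW); [lra|].
  exists W. intros t dt. destruct (HW t dt) as (w & O & iw & (x & ix & wx) & n & Ow & Ot).
  exists w. split; auto. destruct n as (sub & conv & HX & cross & _).
  split; [auto|split; [|split]].
  - exists x. split; auto. apply in_app_or in ix. auto.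
  - intros y iy ty. apply (HX t y); auto. apply in_or_app; auto.
  - intros a u su nu la ta uw. apply (cross t a u); auto.
Qed.

(** At a limit, continuity would force values different from [f y] at earlier points; so the first
    point where [f] leaves the value [f y] is a successor. *)
Lemma first_jump f y s : tree_continuous le f -> y ≼ s -> f y <> f s ->
  exists a u, y ≼ a /\ succ_of le a u /\ u ≼ s /\ (forall z, y ≼ z -> z ≼ a -> f z = f y) /\ f u <> f y.
Proof.
  intros cont ys ne.
  destruct (le_least Htree s (fun z => y ≼ z /\ f z <> f y)) as (u & (yu & nu) & us & umin).
  { exists s. split; [auto|apply (le_refl Htree)]. }
  assert (nyu : y <> u) by (intros ->; auto).
  assert (const : forall z, y ≼ z -> z ≼ u -> z <> u -> f z = f y).
  { intros z yz zu nz. apply NNPP. intros h. apply nz, (le_anti Htree); auto.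
    apply umin; auto. eapply le_tr; eauto. }
  destruct (succ_or_limit Htree y u yu nyu) as [(a & ya & sa)|lim].
  - exists a, u. split; [auto|split; [auto|split; [auto|split; [|auto]]]].
    intros z yz za. destruct (succ_lt Htree a u sa) as [au nau]. apply const; auto.
    + eapply le_tr; eauto.
    + intros ->. apply nau, (le_anti Htree); auto.
  - exfalso.
    assert (pos : 0 < Rabs (f y - f u)) by (apply Rabs_pos_lt; lra).
    destruct (cont u (Rabs (f y - f u)) pos) as (U & Uop & Uu & HU).
    destruct (Uop u Uu) as (l & lu & lU).
    destruct (basic_limit Htree Hhaus l y u yu nyu lim lu) as (a & ya & au & na & la).
    specialize (HU a (lU a la)). rewrite (const a) in HU; auto. lra.
Qed.

Definition jump (f : T -> R) (X : list T) (y a u : T) : Prop :=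
  y ≼ a /\ succ_of le a u /\ (forall z, y ≼ z -> z ≼ a -> f z = f y) /\ f u <> f a /\ down X u.

(** The chain up to each [x] of [X] leaves the value [f y] for the first time only once, so [x]
    contributes at most one pair. *)
Lemma finite_first_jumps f X y : exists l, forall a u, jump f X y a u -> In (a, u) l.
Proof.
  induction X as [|x X (l & Hl)].
  { exists []. intros a u (_ & _ & _ & _ & z & [] & _). }
  destruct (classic (exists a u, jump f [x] y a u)) as [(a & u & j)|no].
  - exists ((a, u) :: l). intros a' u' (ya' & su' & const' & ne' & z & [<-|i] & u'z).
    2:{ right. apply Hl. repeat (split; [assumption|]). exists z; auto. }
    left. destruct j as (ya & su & const & ne & z & [<-|[]] & uz).
    assert (key : forall a u a' u', y ≼ a -> succ_of le a u -> f u <> f a ->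
        (forall z, y ≼ z -> z ≼ a -> f z = f y) -> (forall z, y ≼ z -> z ≼ a' -> f z = f y) ->
        succ_of le a' u' -> u ≼ u' -> u = u').
    { clear - Htree. intros a u a' u' ya su ne const const' su' uu.
      destruct (classic (u = u')) as [|n]; auto. exfalso. apply ne.
      destruct (succ_lt Htree a u su) as [au _].
      rewrite (const' u), (const a); auto.
      - apply (le_refl Htree).
      - eapply le_tr; eauto.
      - apply (succ_pred a' u' u); auto. }
    assert (u = u').
    { destruct (le_chain Htree u u' x uz u'z) as [h|h].
      - apply (key a u a' u'); auto.
      - symmetry. apply (key a' u' a u); auto. }
    subst. f_equal. apply (succ_pred_unique Htree a a' u'); auto.
  - exists l. intros a' u' j. destruct (j) as (ya' & su' & const' & ne' & z & [<-|i] & u'z).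
    + exfalso. apply no. exists a', u'. repeat (split; [assumption|]). exists x; simpl; auto.
    + apply Hl. repeat (split; [assumption|]). exists z; auto.
Qed.

(** A link with large variation of [f] either branches off the large part of [f], leaving a point
    of that part free to be added to [B], or contains one of finitely many jump points [a] of
    [f], where the large jump shows up in the defect at [a] or on a successor of [a]. *)
Lemma gain f eps : inC0 le f -> 0 < eps -> exists gamma c0, 0 < gamma /\
  forall c A B s s', (c0 <= c)%nat -> admissible A B -> linked c A B s s' ->
    eps <= Rabs (f s - f s') ->
    (exists a, admissible (a :: A) B /\ (level a <= c)%nat /\ gamma <= Rabs (defect f a)) \/
    (exists z, admissible A (z :: B) /\ gamma <= Rabs (f z)).
Proof.
  intros Hf eps0. assert (cont := proj1 Hf). assert (HF' := HF). destruct HF' as (Hs & Hnd & _).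
  destruct (C0_cover Htree f (eps / 4) Hf) as (X & HX); [lra|].
  destruct (nice_cover Htree Hhaus F col HF f X 0 (eps / 8) cont) as (W & HW); [lra|].
  destruct (list_collect (fun w p => jump f X w (fst p) (snd p)) W) as (G & HG).
  { intros w _. destruct (finite_first_jumps f X w) as (l & Hl). exists l. intros [a u] j. apply Hl; auto. }
  destruct (uniform_pos (fun p r => f (fst p) <> f (snd p) -> r <= Rabs (f (fst p) - f (snd p))) G)
    as (g0 & g0pos & Hg0).
  { intros p r r' h H ne. specialize (H ne). lra. }
  { intros [a u] _. destruct (Req_dec (f a) (f u)) as [e|ne].
    - exists 1. split; [lra|]. simpl. tauto.
    - exists (Rabs (f a - f u)). split; [apply Rabs_pos_lt; lra|]. simpl. lra. }
  destruct (uniform_nat (fun a m => (level a <= m)%nat) (map fst G ++ X)) as (c0 & Hc0).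
  { intros; lia. }
  { eauto. }
  (* [g0] bounds the listed jumps from below. A jump out of [down X] goes from above [5 * eps / 8]
     to below [eps / 4]. *)
  set (g1 := Rmin g0 (3 * eps / 8)).
  assert (g1pos : 0 < g1) by (apply Rmin_glb_lt; lra).
  (* A jump [f a - f u] is the defect at [a] plus the values on fewer than [c0 + 1] other essential
     successors; if it reaches [g1], one of these terms reaches [g2]. *)
  set (g2 := g1 / (INR c0 + 1)). pose proof (pos_INR c0) as c0pos.
  assert (g2pos : 0 < g2) by (apply Rdiv_lt_0_compat; lra).
  assert (g21 : (INR c0 + 1) * g2 = g1) by (unfold g2; field; lra).
  exists (Rmin g2 (eps / 2)), c0. split; [apply Rmin_glb_lt; lra|].
  assert (m1 : Rmin g2 (eps / 2) <= g2) by apply Rmin_l.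
  assert (m2 : Rmin g2 (eps / 2) <= eps / 2) by apply Rmin_r.
  set (gamma := Rmin g2 (eps / 2)) in *. clearbody gamma.
  intros c A B s s' cc adm lk big.
  assert (lk' := lk). destruct lk' as (ss & _ & up & cross).
  assert (at_jump : forall a u, s ≼ a -> succ_of le a u -> u ≼ s' -> (level a <= c0)%nat ->
     g1 <= Rabs (f a - f u) ->
     (exists a, admissible (a :: A) B /\ (level a <= c)%nat /\ gamma <= Rabs (defect f a)) \/
     (exists z, admissible A (z :: B) /\ gamma <= Rabs (f z))).
  { intros a u sa su us la j. destruct (succ_lt Htree a u su) as [au nau].
    assert (as' : a ≼ s') by (apply (le_tr Htree a u s'); auto).
    assert (na : a <> s') by (intros ->; apply nau, (le_anti Htree); auto).
    assert (iu : In u (F a)).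
    { apply NNPP. intros ni. apply (cross a u); auto. lia. }
    destruct (Rle_lt_dec gamma (Rabs (defect f a))) as [h|h].
    { left. exists a. split; [|split; [lia|auto]].
      apply (linked_extend_l c A B s s'); auto. }
    right. apply NNPP. intros no.
    assert (h' : Rabs (sumR f (F a) - f u) <= INR (length (F a)) * g2).
    { apply sum_one_large; auto; [lra|]. intros z iz nz. apply Rlt_le, Rnot_le_lt. intros hz.
      apply no. exists z. split; [|lra]. apply (linked_extend_r c A B s s' a z); auto.
      intros zs. apply nz. apply (succ_eq_of_bound Htree a z u s'); auto. }
    assert (INR (length (F a)) <= INR c0) by (apply le_INR; unfold level_of in la; lia).
    assert (INR (length (F a)) * g2 <= INR c0 * g2) by (apply Rmult_le_compat_r; lra).
    replace (f a - f u) with (defect f a + (sumR f (F a) - f u)) in j by (unfold defect_of; lra).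
    pose proof (Rabs_triang (defect f a) (sumR f (F a) - f u)). lra. }
  assert (free : forall a z, s ≼ a -> a ≼ s' -> a <> s' -> succ_of le a z -> ~ z ≼ s' ->
     eps / 2 <= Rabs (f z) ->
     (exists a, admissible (a :: A) B /\ (level a <= c)%nat /\ gamma <= Rabs (defect f a)) \/
     (exists z, admissible A (z :: B) /\ gamma <= Rabs (f z))).
  { intros a z sa as' na sz nz h. right. exists z. split; [|lra].
    apply (linked_extend_r c A B s s' a z); auto. }
  assert (tri : forall x y, Rabs x <= Rabs y + Rabs (x - y)).
  { intros x y. replace x with (y + (x - y)) at 1 by lra. apply Rabs_triang. }
  assert (outside : forall z, ~ down X z -> Rabs (f z) < eps / 4).
  { intros z nz. apply Rnot_le_lt. intros h. auto. }
  assert (ds : down X s).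
  { apply NNPP. intros ns.
    assert (Rabs (f s) < eps / 4) by auto.
    assert (Rabs (f s') < eps / 4).
    { apply outside. intros h. apply ns. apply (down_le Htree X s s'); auto. }
    pose proof (Rabs_triang (f s) (- f s')) as h. rewrite Rabs_Ropp in h. unfold Rminus in big. lra. }
  destruct (HW s ds) as (w & O & iw & dw & n & Ow & Os).
  assert (n' := n). destruct n' as (sub & conv & HXO & _ & osc).
  assert (sw := sub s Os). assert (osc_s := osc s Os).
  destruct (classic (s' ≼ w)) as [s'w|ns'w].
  { exfalso. assert (o := osc s' (conv s s' Os ss s'w)).
    replace (f s - f s') with ((f s - f w) + - (f s' - f w)) in big by lra.
    pose proof (Rabs_triang (f s - f w) (- (f s' - f w))) as h. rewrite Rabs_Ropp in h. lra. }
  (* At [m] the way to [s'] parts from the way to [w]. If [m = w], the variation occurs beyond [w].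
     Otherwise the link leaves [down X], so [f s'] is small, and the successor of [m] towards [w] is
     a free point with a large value. *)
  destruct (meet_exists Htree Hhaus w s' s sw ss) as (m & mw & ms' & mmax).
  assert (sm : s ≼ m) by auto.
  assert (nms' : m <> s') by (intros ->; auto).
  assert (Om : O m) by (apply (conv s m); auto).
  destruct (classic (m = w)) as [->|nmw].
  - assert (fws : 7 * eps / 8 < Rabs (f w - f s')).
    { replace (f s - f s') with ((f s - f w) + (f w - f s')) in big by lra.
      pose proof (Rabs_triang (f s - f w) (f w - f s')). lra. }
    assert (ne : f w <> f s').
    { intros e. rewrite e, Rminus_diag, Rabs_R0 in fws. lra. }
    destruct (first_jump f w s' cont ms' ne) as (a & u & wa & su & us & const & nu).
    destruct (succ_lt Htree a u su) as [au nau].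
    assert (fa : f a = f w) by (apply const; auto; apply (le_refl Htree)).
    assert (sa : s ≼ a) by (eapply le_tr; eauto).
    assert (in_list : forall u1, jump f X w a u1 -> (level a <= c0)%nat).
    { intros u1 j. apply Hc0. apply in_or_app. left.
      change a with (fst (a, u1)). apply in_map. apply (HG w); auto. }
    destruct (classic (down X u)) as [du|ndu].
    + assert (j : jump f X w a u).
      { split; [auto|split; [auto|split; [auto|split; [congruence|auto]]]]. }
      apply (at_jump a u); auto; [apply (in_list u); auto|].
      apply Rle_trans with g0; [apply Rmin_l|].
      apply (Hg0 (a, u)); [apply (HG w); auto|simpl; congruence].
    + assert (fs' : Rabs (f s') < eps / 4).
      { apply outside. intros h. apply ndu. apply (down_le Htree X u s'); auto. }
      assert (fu := outside u ndu).
      assert (fw : 5 * eps / 8 < Rabs (f a)).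
      { rewrite fa. pose proof (Rabs_triang (f w) (- f s')) as h. rewrite Rabs_Ropp in h.
        unfold Rminus in fws. lra. }
      assert (big_jump : g1 <= Rabs (f a - f u)).
      { apply Rle_trans with (3 * eps / 8); [apply Rmin_r|].
        specialize (tri (f a) (f u)). lra. }
      (* Since [u] is off [down X], the level of [a] needs another bound: [a] is in [X], or its
         successor [v] towards [X] keeps the value and is free, or [v] shows that [a] is a listed
         jump point. *)
      destruct (HX a) as (x & ix & ax); [lra|].
      assert (as' : a ≼ s') by (apply (le_tr Htree a u s'); auto).
      assert (na : a <> s') by (intros ->; apply nau, (le_anti Htree); auto).
      destruct (classic (a = x)) as [->|nax].
      { apply (at_jump x u); auto. apply Hc0. apply in_or_app; auto. }
      destruct (succ_toward Htree a x ax nax) as (v & sv & vx).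
      destruct (Req_dec (f v) (f a)) as [e|nv].
      * apply (free a v); auto; [|rewrite e; lra].
        intros vs. apply nu. rewrite <- (succ_eq_of_bound Htree a v u s'); auto. congruence.
      * apply (at_jump a u); auto. apply (in_list v).
        split; [auto|split; [auto|split; [auto|split; [auto|exists x; auto]]]].
  - destruct (succ_toward Htree m w mw nmw) as (u & su & uw).
    destruct (succ_lt Htree m u su) as [mu nmu].
    apply (free m u); auto.
    + intros us. apply (succ_not_le_pred Htree m u); auto.
    + assert (nds : ~ down X s').
      { destruct (succ_toward Htree m s' ms' nms') as (v & sv & vs).
        intros h. apply (branch_off_nbhd Htree F col f X 0 (eps / 8) w O m v); auto.
        - intros vw. apply (succ_not_le_pred Htree m v); auto.
        - apply (down_le Htree X v s'); auto. }
      assert (fs' := outside s' nds).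
      assert (Ou : O u) by (apply (conv m u); auto).
      assert (osc_u := osc u Ou).
      assert (t1 := tri (f s) (f w)).
      assert (t2 := tri (f w) (f u)). rewrite Rabs_minus_sym in t2.
      pose proof (Rabs_triang (f s) (- f s')) as h. rewrite Rabs_Ropp in h. unfold Rminus in big. lra.
Qed.

End Gain.

(** * The seminorms *)

Section Seminorms.
Context {T : Type} {le : T -> T -> Prop} (Htree : is_tree le) (Hhaus : hausdorff_tree le).
Context (F : T -> list T) (col : T -> nat) (HF : branching (le := le) F col).
Local Notation "s ≼ t" := (le s t) (at level 70).
Local Notation down := (down (le := le)).
Local Notation level := (level_of F col).
Local Notation defect := (defect_of F).
Local Notation admissible := (admissible (le := le)).
Local Notation weight := (weight_of F).
Local Notation linked := (linked (le := le) F col).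

Definition test : Type := (list T * list T * option (T * T))%type.

Definition test_ok (c n : nat) (i : test) : Prop :=
  let '(A, B, o) := i in admissible A B /\ (forall a, In a A -> (level a <= c)%nat) /\
    (length A <= n)%nat /\ (length B <= n)%nat /\
    match o with None => True | Some (s, s') => linked c A B s s' end.

Definition oscillation (k : nat) (o : option (T * T)) (f : T -> R) : R :=
  match o with None => 0 | Some (s, s') => Rabs (f s - f s') / (INR k + 1) end.

Definition test_value (k : nat) (i : test) (f : T -> R) : R :=
  let '(A, B, o) := i in weight f A B + oscillation k o f.

Definition test_support (i : test) : list T :=
  let '(A, B, o) := i in
  A ++ flat_map F A ++ B ++ match o with None => [] | Some (s, s') => [s; s'] end.

Lemma INR1_pos k : 0 < INR k + 1.
Proof. pose proof (pos_INR k). lra. Qed.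

Lemma weight_nonneg f A B : 0 <= weight f A B.
Proof.
  unfold weight_of. apply Rplus_le_le_0_compat; apply sumR_nonneg; intros; apply Rabs_pos.
Qed.

Lemma oscillation_nonneg k o f : 0 <= oscillation k o f.
Proof.
  destruct o as [[s s']|]; simpl; [|lra]. apply Rle_mult_inv_pos; [apply Rabs_pos|apply INR1_pos].
Qed.

Lemma test_value_nonneg k i f : 0 <= test_value k i f.
Proof.
  destruct i as [[A B] o]. simpl.
  pose proof (weight_nonneg f A B). pose proof (oscillation_nonneg k o f). lra.
Qed.

Lemma defect_add f g a : defect (fadd f g) a = defect f a + defect g a.
Proof.
  unfold defect_of, fadd. rewrite (sumR_plus f g). lra.
Qed.

Lemma defect_scal x f a : defect (fscal x f) a = x * defect f a.
Proof. unfold defect_of, fscal. rewrite (sumR_scal x f). lra. Qed.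

Lemma weight_add f g A B : weight (fadd f g) A B <= weight f A B + weight g A B.
Proof.
  unfold weight_of.
  assert (sumR (fun a => Rabs (defect (fadd f g) a)) A <=
    sumR (fun a => Rabs (defect f a)) A + sumR (fun a => Rabs (defect g a)) A).
  { rewrite <- sumR_plus. apply sumR_le. intros. rewrite defect_add. apply Rabs_triang. }
  assert (sumR (fun r => Rabs (fadd f g r)) B <=
    sumR (fun r => Rabs (f r)) B + sumR (fun r => Rabs (g r)) B).
  { rewrite <- sumR_plus. apply sumR_le. intros. apply Rabs_triang. }
  lra.
Qed.

Lemma test_value_add k i f g :
  test_value k i (fadd f g) <= test_value k i f + test_value k i g.
Proof.
  destruct i as [[A B] o]. simpl.
  assert (oscillation k o (fadd f g) <= oscillation k o f + oscillation k o g).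
  { destruct o as [[s s']|]; simpl; [|lra]. unfold Rdiv. rewrite <- Rmult_plus_distr_r.
    apply Rmult_le_compat_r; [apply Rlt_le, Rinv_0_lt_compat, INR1_pos|].
    unfold fadd. replace (f s + g s - (f s' + g s')) with ((f s - f s') + (g s - g s')) by lra.
    apply Rabs_triang. }
  pose proof (weight_add f g A B). lra.
Qed.

Lemma test_value_scal k i x f : test_value k i (fscal x f) = Rabs x * test_value k i f.
Proof.
  destruct i as [[A B] o]. simpl.
  assert (weight (fscal x f) A B = Rabs x * weight f A B).
  { unfold weight_of. rewrite Rmult_plus_distr_l, <- !sumR_scal. f_equal.
    - apply sumR_ext. intros. rewrite defect_scal. apply Rabs_mult.
    - apply sumR_ext. intros. apply Rabs_mult. }
  assert (oscillation k o (fscal x f) = Rabs x * oscillation k o f).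
  { destruct o as [[s s']|]; simpl; [|lra]. unfold fscal.
    replace (x * f s - x * f s') with (x * (f s - f s')) by lra.
    rewrite Rabs_mult. unfold Rdiv. lra. }
  lra.
Qed.

(** Per unit of the supremum norm: [c + 1] for each of [n] defects, 1 for each of [n] values, 2 for
    the oscillation. *)
Definition test_bound (c n : nat) : R := INR n * (INR c + 2) + 2.

Lemma weight_bound c n A B f M : 0 <= M -> (forall a, In a A -> (level a <= c)%nat) ->
  (length A <= n)%nat -> (length B <= n)%nat ->
  (forall t, In t (A ++ flat_map F A ++ B) -> Rabs (f t) <= M) ->
  weight f A B <= INR n * (INR c + 2) * M.
Proof.
  intros M0 lev lA lB H.
  assert (hA : sumR (fun a => Rabs (defect f a)) A <= INR (length A) * ((INR c + 1) * M)).
  { apply sumR_bound. intros a i. unfold defect_of, Rminus.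
    eapply Rle_trans; [apply Rabs_triang|]. rewrite Rabs_Ropp.
    assert (h1 : Rabs (f a) <= M) by (apply H, in_or_app; auto).
    assert (h2 : Rabs (sumR f (F a)) <= INR (length (F a)) * M).
    { eapply Rle_trans; [apply sumR_Rabs|]. apply sumR_bound. intros u iu. apply H.
      apply in_or_app. right. apply in_or_app. left. apply in_flat_map. eauto. }
    assert (h3 : INR (length (F a)) <= INR c).
    { apply le_INR. specialize (lev a i). unfold level_of in lev. lia. }
    assert (INR (length (F a)) * M <= INR c * M) by (apply Rmult_le_compat_r; auto). lra. }
  assert (hB : sumR (fun r => Rabs (f r)) B <= INR (length B) * M).
  { apply sumR_bound. intros r i. apply H. rewrite !in_app_iff. auto. }
  apply le_INR in lA, lB. unfold weight_of. pose proof (pos_INR c).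
  assert (INR (length A) * ((INR c + 1) * M) <= INR n * ((INR c + 1) * M)).
  { apply Rmult_le_compat_r; auto. apply Rmult_le_pos; lra. }
  assert (INR (length B) * M <= INR n * M) by (apply Rmult_le_compat_r; auto). lra.
Qed.

Lemma test_value_bound c k n i f M : test_ok c n i -> 0 <= M ->
  (forall t, In t (test_support i) -> Rabs (f t) <= M) -> test_value k i f <= test_bound c n * M.
Proof.
  destruct i as [[A B] o]. simpl. intros (adm & lev & lA & lB & _) M0 H. unfold test_bound.
  assert (weight f A B <= INR n * (INR c + 2) * M).
  { apply weight_bound; auto. intros t i. apply H. rewrite !in_app_iff in *. tauto. }
  assert (oscillation k o f <= 2 * M); [|lra].
  destruct o as [[s s']|]; simpl; [|lra]. pose proof (pos_INR k).
  apply (Rmult_le_reg_r (INR k + 1)); [lra|].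
  replace (Rabs (f s - f s') / (INR k + 1) * (INR k + 1)) with (Rabs (f s - f s')) by (field; lra).
  assert (Rabs (f s) <= M) by (apply H; rewrite !in_app_iff; simpl; auto).
  assert (Rabs (f s') <= M) by (apply H; rewrite !in_app_iff; simpl; auto 6).
  pose proof (Rabs_triang (f s) (- f s')) as h. rewrite Rabs_Ropp in h. unfold Rminus.
  assert (0 <= INR k * (2 * M)) by (apply Rmult_le_pos; lra). lra.
Qed.

(** Only finitely many defects at levels up to [c] reach [eta], and an antichain has at most
    [length X] points where [f] does. Past [n0], the [m] surplus points of each list can thus be
    chosen small, at a cost of at most [tau / 2] per list. *)
Lemma weight_drop f c m tau : inC0 le f -> 0 < tau -> exists n0, forall n A B, (n0 <= n)%nat ->
  admissible A B -> (forall a, In a A -> (level a <= c)%nat) ->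
  (length A <= n + m)%nat -> (length B <= n + m)%nat ->
  exists A' B', admissible A' B' /\ incl A' A /\ incl B' B /\
    (length A' <= n)%nat /\ (length B' <= n)%nat /\ weight f A B <= weight f A' B' + tau.
Proof.
  intros Hf t0. pose proof (INR1_pos m) as m0. pose proof (pos_INR m).
  set (eta := tau / (2 * (INR m + 1))).
  assert (eta0 : 0 < eta) by (apply Rdiv_lt_0_compat; lra).
  assert (em : (INR m + 1) * eta = tau / 2) by (unfold eta; field; lra).
  destruct (finite_large_defects Htree Hhaus F col HF f c eta Hf eta0) as (W & HW).
  destruct (C0_cover Htree f eta Hf eta0) as (X & HX).
  exists (max (length W) (length X)). intros n A B hn adm lev lA lB.
  assert (adm' := adm). destruct adm' as (nA & nB & anti & _).
  destruct (sumR_drop_small (fun a => Rabs (defect f a)) eta (length W) n ltac:(lia) m A nA)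
    as (A' & nA' & iA & lA' & sA); [|auto|].
  { intros l nl inc big. apply NoDup_incl_length; auto. intros a i. apply HW; auto. }
  destruct (sumR_drop_small (fun a => Rabs (f a)) eta (length X) n ltac:(lia) m B nB)
    as (B' & nB' & iB & lB' & sB); [|auto|].
  { intros l nl inc big. apply (antichain_length Htree (le := le)); auto.
    intros r r' i i'. apply anti; auto. }
  exists A', B'. split; [apply (admissible_incl A B); auto|]. repeat (split; [assumption|]).
  unfold weight_of. rewrite Rmax_left in sA, sB by lra. lra.
Qed.

Lemma weight_near_max f c n tau : inC0 le f -> 0 < tau -> exists A B,
  test_ok c n (A, B, None) /\
  forall A' B', test_ok c n (A', B', None) -> weight f A' B' <= weight f A B + tau.
Proof.
  intros Hf t0. destruct (C0_bounded Htree Hhaus f Hf) as (M & HM).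
  assert (nil_ok : test_ok c n ([], [], None)).
  { simpl. split; [apply admissible_nil|]. split; [tauto|]. split; [lia|]. split; [lia|auto]. }
  destruct (completeness (fun y => exists A B, test_ok c n (A, B, None) /\ y = weight f A B))
    as (m & ub & lub).
  - exists (INR n * (INR c + 2) * Rmax M 0). intros y (A & B & (_ & lev & lA & lB & _) & ->).
    apply weight_bound; auto; [apply Rmax_r|]. intros t _. eapply Rle_trans; [apply HM|apply Rmax_l].
  - exists (weight f [] []). exists [], []. auto.
  - apply NNPP. intros no. assert (m <= m - tau); [|lra].
    apply lub. intros y (A & B & ok & ->). apply Rnot_lt_le. intros h. apply no.
    exists A, B. split; auto. intros A' B' ok'.
    assert (weight f A' B' <= m) by (apply ub; eauto). lra.
Qed.

(** A nearly maximal pair for [weight f] of the form given by [transport] forces every [g] as in the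
    conclusion to be small off [down (A ++ B)] and nearly constant along links. *)
Lemma tests_separate f eps : inC0 le f -> 0 < eps -> exists c k n delta W, 0 < delta /\
  forall g, (forall w, In w W -> Rabs (g w - f w) < delta) ->
    (forall i', test_ok c n i' -> exists i, test_ok c n i /\ test_value k i' g <= test_value k i f + delta) ->
    forall t, Rabs (g t - f t) <= eps.
Proof.
  (* Off the part below [A] and [B], [f] and [g] will each be bounded by [5 * e]. *)
  intros Hf eps0. set (e := eps / 10). assert (e0 : 0 < e) by (unfold e; lra).
  destruct (gain Htree Hhaus F col HF f e Hf e0) as (gamma & c0 & gamma0 & Hgain).
  destruct (C0_bounded Htree Hhaus f Hf) as (M & HM).
  (* With this [k] no oscillation term of [f] exceeds [gamma / 2], so a test whose pair varies by
     [e], and whose lists still have a gain [gamma] available, cannot beat [w0 + tau]. *)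
  destruct (INR_unbounded (4 * M / gamma)) as (k & Hk).
  pose proof (pos_INR k) as k0. set (K := INR k + 1). assert (K0 : 0 < K) by (unfold K; lra).
  assert (HK : 2 * M / K <= gamma / 2).
  { apply (Rmult_le_reg_r (2 * K)); [lra|].
    replace (2 * M / K * (2 * K)) with (4 * M) by (field; lra).
    assert (4 * M < INR k * gamma); [|unfold K; lra].
    apply (Rmult_lt_reg_r (/ gamma)); [apply Rinv_0_lt_compat; auto|].
    replace (INR k * gamma * / gamma) with (INR k) by (field; lra). exact Hk. }
  set (eK := e / K). assert (eK0 : 0 < eK) by (apply Rdiv_lt_0_compat; auto).
  set (tau := Rmin (eK / 4) (gamma / 2)).
  assert (t0 : 0 < tau) by (apply Rmin_glb_lt; lra).
  assert (t1 : tau <= eK / 4) by apply Rmin_l. assert (t2 : tau <= gamma / 2) by apply Rmin_r.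
  destruct (C0_cover Htree f e Hf e0) as (X & HX).
  set (q := length X). pose proof (INR1_pos q) as q0.
  destruct (transport Htree Hhaus F col HF f Hf e e0 (tau / (INR q + 1))) as (m & Hm).
  { apply Rdiv_lt_0_compat; auto. }
  set (c := max c0 m).
  (* Transport adds at most [q * m] points to each list; the 1 covers the point supplied by [gain]
     and the descent from [n] to [n1]. *)
  destruct (weight_drop f c (1 + q * m) tau Hf t0) as (n1 & Hdrop).
  (* The final pair has at most [n1] points per list, which leaves one place in [B] for a further
     point. *)
  set (n := S n1).
  destruct (weight_near_max f c n tau Hf t0) as (A0 & B0 & (adm0 & lev0 & lA0 & lB0 & _) & Hmax).
  set (w0 := weight f A0 B0) in *.
  assert (upper : forall i, test_ok c n i -> test_value k i f <= w0 + tau + eK).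
  { intros [[A B] o] (adm & lev & lA & lB & Ho). simpl.
    assert (ABmax : weight f A B <= w0 + tau) by (apply Hmax; simpl; auto).
    destruct o as [[s s']|]; simpl; [|lra].
    destruct (Rle_lt_dec e (Rabs (f s - f s'))) as [big|small].
    - assert (G : exists A' B', admissible A' B' /\ (forall a, In a A' -> (level a <= c)%nat) /\
         (length A' <= n + (1 + q * m))%nat /\ (length B' <= n + (1 + q * m))%nat /\
         weight f A B + gamma <= weight f A' B').
      { destruct (Hgain c A B s s' ltac:(unfold c; lia) adm Ho big)
          as [(a & adm' & la & ha)|(z & adm' & hz)].
        - exists (a :: A), B. split; [auto|]. split; [intros x [<-|i]; auto|].
          simpl. split; [lia|]. split; [lia|]. unfold weight_of. simpl. lra.
        - exists A, (z :: B). split; [auto|]. split; [auto|].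
          simpl. split; [lia|]. split; [lia|]. unfold weight_of. simpl. lra. }
      destruct G as (A' & B' & adm' & lev' & lA' & lB' & w').
      destruct (Hdrop n A' B' ltac:(unfold n; lia) adm' lev' lA' lB')
        as (A2 & B2 & adm2 & iA & iB & lA2 & lB2 & w2).
      assert (weight f A2 B2 <= w0 + tau) by (apply Hmax; simpl; auto).
      assert (Rabs (f s - f s') / K <= 2 * M / K).
      { apply Rmult_le_compat_r; [apply Rlt_le, Rinv_0_lt_compat; auto|].
        pose proof (HM s). pose proof (HM s').
        pose proof (Rabs_triang (f s) (- f s')) as h. rewrite Rabs_Ropp in h. unfold Rminus. lra. }
      fold K. lra.
    - assert (Rabs (f s - f s') / K <= eK); [|fold K; lra].
      apply Rmult_le_compat_r; [apply Rlt_le, Rinv_0_lt_compat; auto|lra]. }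
  assert (P : exists A B, admissible A B /\ (forall a, In a A -> (level a <= c)%nat) /\
     (length A <= n1)%nat /\ (length B <= n1)%nat /\ (forall r, In r B -> Rabs (f r) < e) /\
     w0 <= weight f A B + 2 * tau).
  { destruct (list_partition (fun r => e <= Rabs (f r)) B0) as (Bb & Bs & perm & big & small).
    assert (admp := admissible_perm A0 B0 _ perm adm0).
    destruct (Hm Bb A0 Bs admp big) as (A1 & B1 & adm1 & sm1 & w1 & lA1 & lB1 & lev1).
    { intros r i. apply Rnot_le_lt. apply small; auto. }
    assert (lb : (length Bb <= q)%nat).
    { destruct admp as (_ & nB & anti & _). apply (antichain_length Htree (le := le)); auto.
      - apply NoDup_app_remove_r in nB; auto.
      - intros r r' i i'. apply anti; apply in_or_app; auto. }
    assert (ls : (length Bb + length Bs <= n)%nat).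
    { rewrite <- length_app, <- (Permutation_length perm). auto. }
    assert (lm : (length Bb * m <= q * m)%nat) by (apply Nat.mul_le_mono_r; auto).
    destruct (Hdrop n1 A1 B1) as (A2 & B2 & adm2 & iA & iB & lA2 & lB2 & w2); auto.
    { intros a i. destruct (lev1 a i) as [j|j]; auto. unfold c. lia. }
    { unfold n in lA0. lia. }
    { unfold n in ls. lia. }
    exists A2, B2. split; [auto|]. split.
    { intros a i. destruct (lev1 a (iA a i)) as [j|j]; auto. unfold c. lia. }
    split; [auto|]. split; [auto|]. split; [auto|].
    assert (w0 = weight f A0 (Bb ++ Bs)).
    { unfold w0, weight_of. f_equal. apply sumR_perm; auto. }
    assert (INR (length Bb) * (tau / (INR q + 1)) <= tau); [|lra].
    replace tau with ((INR q + 1) * (tau / (INR q + 1))) at 2 by (field; lra).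
    apply Rmult_le_compat_r; [apply Rlt_le, Rdiv_lt_0_compat; auto|]. apply le_INR in lb. fold q in lb. lra. }
  destruct P as (A & B & adm & lev & lA & lB & small & wAB).
  destruct (linked_representatives Htree Hhaus F col HF c A B) as (W & HW).
  set (D := test_bound c n). assert (D0 : 0 < D).
  { unfold D, test_bound. pose proof (pos_INR c).
    pose proof (Rmult_le_pos (INR n) (INR c + 2) (pos_INR n)). lra. }
  set (delta := Rmin e (Rmin (eK / 4) (eK / (4 * D)))).
  assert (d0 : 0 < delta).
  { apply Rmin_glb_lt; auto. apply Rmin_glb_lt; [lra|apply Rdiv_lt_0_compat; lra]. }
  assert (d1 : delta <= e) by apply Rmin_l.
  assert (d2 : delta <= eK / 4) by (eapply Rle_trans; [apply Rmin_r|apply Rmin_l]).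
  assert (d3 : D * delta <= eK / 4).
  { apply Rle_trans with (D * (eK / (4 * D))).
    - apply Rmult_le_compat_l; [lra|]. eapply Rle_trans; [apply Rmin_r|apply Rmin_r].
    - right. field. lra. }
  exists c, k, n, delta, (test_support (A, B, None) ++ W). split; auto.
  assert (control : forall g, (forall w, In w (test_support (A, B, None)) -> Rabs (g w - f w) < delta) ->
    (forall i', test_ok c n i' -> exists i, test_ok c n i /\ test_value k i' g <= test_value k i f + delta) ->
    (forall s s', linked c A B s s' -> Rabs (g s - g s') <= 3 * e) /\
    (forall t, ~ down (A ++ B) t -> Rabs (g t) <= 5 * e)).
  { intros g near Hg.
    assert (ok : test_ok c n (A, B, None)).
    { simpl. split; [auto|]. split; [auto|]. split; [unfold n; lia|]. split; [unfold n; lia|auto]. }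
    assert (wg : weight f A B <= weight g A B + eK / 4).
    { assert (E : f = fadd g (fsub f g)).
      { apply functional_extensionality. intros t. unfold fadd, fsub. lra. }
      rewrite E at 1. eapply Rle_trans; [apply weight_add|].
      assert (h := test_value_bound c k n (A, B, None) (fsub f g) delta ok (Rlt_le _ _ d0)).
      simpl in h. rewrite Rplus_0_r in h. fold D in h. apply Rplus_le_compat_l.
      eapply Rle_trans; [apply h|lra]. intros t i. unfold fsub. rewrite Rabs_minus_sym.
      apply Rlt_le, near. exact i. }
    (* The losses are [2 * tau] from [wAB], [tau + eK] from [upper], [delta], and [eK / 4] from
       [wg]. *)
    assert (cap : forall i', test_ok c n i' -> test_value k i' g <= weight g A B + 3 * eK).
    { intros i' ok'. destruct (Hg i' ok') as (i & oki & h). specialize (upper i oki). lra. }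
    assert (eKe : eK <= e).
    { unfold eK. apply (Rmult_le_reg_r K); auto. replace (e / K * K) with e by (field; lra).
      assert (0 <= e * INR k) by (apply Rmult_le_pos; lra). unfold K. lra. }
    split.
    - intros s s' lk. assert (h := cap (A, B, Some (s, s'))). simpl in h.
      assert (h' : Rabs (g s - g s') / K <= 3 * eK).
      { fold K in h. simpl in ok. destruct ok as (? & ? & ? & ? & _).
        assert (weight g A B + Rabs (g s - g s') / K <= weight g A B + 3 * eK); [|lra].
        apply h; auto. }
      apply (Rmult_le_reg_r (/ K)); [apply Rinv_0_lt_compat; auto|]. unfold eK in h'. unfold Rdiv in h'. lra.
    - intros t nt.
      assert (out : forall x, In x A \/ In x B -> ~ t ≼ x).
      { intros x i tx. apply nt. exists x. split; auto. apply in_or_app; auto. }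
      assert (adm' := adm). destruct adm' as (nA & nB & anti & sep).
      (* A point [t] above some [r] of [B] takes its place, and [g r] is small because [f r] is; any
         other [t] is added to [B]. *)
      destruct (classic (exists r, In r B /\ r ≼ t)) as [(r & ir & rt)|no].
      + destruct (in_split r B ir) as (B1 & B2 & eB).
        assert (perm : Permutation B (r :: B1 ++ B2)).
        { rewrite eB. symmetry. apply Permutation_middle. }
        assert (admt : admissible ([] ++ A) ([t] ++ (B1 ++ B2))).
        { apply (admissible_replace Htree A (B1 ++ B2) [] [t] r).
          - apply (admissible_perm A B); auto.
          - split; [apply NoDup_nil|]. split; [constructor; auto using NoDup_nil|].
            split; [intros x y [<-|[]] [<-|[]]; auto|intros x y _ []].
          - intros z [[]|[<-|[]]]; auto. }
        assert (h := cap (A, t :: (B1 ++ B2), None)). simpl in h.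
        assert (lB' := Permutation_length perm). simpl in lB'.
        assert (h' : weight g A (t :: B1 ++ B2) + 0 <= weight g A B + 3 * eK).
        { apply h. split; [auto|]. split; [auto|]. split; [unfold n; lia|]. split; [unfold n; lia|auto]. }
        assert (weight g A B = weight g A (r :: B1 ++ B2)).
        { unfold weight_of. f_equal. apply sumR_perm; auto. }
        assert (Rabs (g r) <= 2 * e).
        { assert (Rabs (g r - f r) < delta) by (apply near; simpl; rewrite !in_app_iff; auto).
          specialize (small r ir). replace (g r) with ((g r - f r) + f r) by lra.
          eapply Rle_trans; [apply Rabs_triang|]. lra. }
        unfold weight_of in *. simpl in *. lra.
      + assert (h := cap (A, t :: B, None)). simpl in h.
        assert (h' : weight g A (t :: B) + 0 <= weight g A B + 3 * eK).
        { apply h. split; [|split; [auto|split; [unfold n; lia|split; [unfold n; lia|auto]]]].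
          split; [auto|]. split.
          { constructor; auto. intros i. apply (out t); auto. apply (le_refl Htree). }
          split.
          - intros x y [<-|i] [<-|i'] l; auto.
            + exfalso. apply (out y); auto.
            + exfalso. apply no. exists x; auto.
          - intros x a [<-|i] ia; [apply out; auto|apply sep; auto]. }
        unfold weight_of in *. simpl in *. lra. }
  intros g near Hg t.
  destruct (control g) as [Lg Og]; auto.
  { intros w i. apply near. apply in_or_app; auto. }
  (* [f] itself meets the conditions on [g], so the same bounds hold for it. *)
  destruct (control f) as [Lf Of].
  { intros w i. rewrite Rminus_diag, Rabs_R0. auto. }
  { intros i ok. exists i. split; auto. lra. }
  destruct (classic (down (A ++ B) t)) as [dt|nt].
  - destruct (HW t dt) as (w & iw & lk). specialize (Lg t w lk). specialize (Lf t w lk).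
    assert (Rabs (g w - f w) < delta) by (apply near; apply in_or_app; auto).
    replace (g t - f t) with ((g t - g w) + ((g w - f w) + - (f t - f w))) by lra.
    eapply Rle_trans; [apply Rabs_triang|].
    pose proof (Rabs_triang (g w - f w) (- (f t - f w))) as h. rewrite Rabs_Ropp in h. unfold e in *. lra.
  - specialize (Og t nt). specialize (Of t nt). unfold Rminus.
    eapply Rle_trans; [apply Rabs_triang|]. rewrite Rabs_Ropp. unfold e in *. lra.
Qed.

End Seminorms.

(** * The Kadec norm *)

Lemma sumR_In {X} (v : X -> R) l x : (forall y, In y l -> 0 <= v y) -> In x l -> v x <= sumR v l.
Proof.
  induction l as [|a l IH]; intros pos []; simpl.
  - subst. assert (0 <= sumR v l) by (apply sumR_nonneg; intros; apply pos; simpl; auto). lra.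
  - assert (0 <= v a) by (apply pos; simpl; auto).
    assert (v x <= sumR v l); [|lra]. apply IH; auto. intros; apply pos; simpl; auto.
Qed.

Lemma sumR_update (v v' : nat -> R) l j : NoDup l -> In j l -> (forall i, i <> j -> v' i = v i) ->
  sumR v' l = sumR v l + (v' j - v j).
Proof.
  intros nd i H. apply in_split in i. destruct i as (l1 & l2 & ->).
  assert (ni := NoDup_remove_2 _ _ _ nd). rewrite !sumR_app. simpl.
  rewrite (sumR_ext v' v l1), (sumR_ext v' v l2).
  - lra.
  - intros x i. apply H. intros ->. apply ni, in_or_app; auto.
  - intros x i. apply H. intros ->. apply ni, in_or_app; auto.
Qed.

Lemma sumR_half_pow m : sumR (fun j => (/ 2) ^ S j) (seq 0 m) <= 1.
Proof.
  assert (E : sumR (fun j => (/ 2) ^ S j) (seq 0 m) = 1 - (/ 2) ^ m).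
  { induction m as [|m IH]; [simpl; lra|].
    rewrite seq_S, sumR_app, IH. simpl. lra. }
  rewrite E. assert (0 < (/ 2) ^ m) by (apply pow_lt; lra). lra.
Qed.

Section Norm.
Context {T : Type} {le : T -> T -> Prop} (Htree : is_tree le) (Hhaus : hausdorff_tree le).
Context (F : T -> list T) (col : T -> nat) (HF : branching (le := le) F col).
Local Notation test := (test (T := T)).
Local Notation test_ok := (test_ok (le := le) F col).
Local Notation test_value := (test_value F).
Local Notation test_support := (test_support F).

Definition par_c (j : nat) : nat := fst (Cantor.of_nat j).
Definition par_k (j : nat) : nat := fst (Cantor.of_nat (snd (Cantor.of_nat j))).
Definition par_n (j : nat) : nat := snd (Cantor.of_nat (snd (Cantor.of_nat j))).

Lemma par_exists c k n : exists j, par_c j = c /\ par_k j = k /\ par_n j = n.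
Proof.
  exists (Cantor.to_nat (c, Cantor.to_nat (k, n))). unfold par_c, par_k, par_n.
  rewrite !Cantor.cancel_of_to. cbn [fst snd]. rewrite !Cantor.cancel_of_to. auto.
Qed.

(** Dividing by [test_bound] keeps the term of index [j] within [(/ 2) ^ S j] times the supremum
    norm, so the terms sum to at most that norm. *)
Definition coef (j : nat) : R := (/ 2) ^ S j / test_bound (par_c j) (par_n j).

Lemma test_bound_ge_1 c n : 1 <= test_bound c n.
Proof.
  unfold test_bound. pose proof (pos_INR c).
  assert (0 <= INR n * (INR c + 2)) by (apply Rmult_le_pos; [apply pos_INR|lra]). lra.
Qed.

Lemma coef_pos j : 0 < coef j.
Proof.
  pose proof (test_bound_ge_1 (par_c j) (par_n j)).
  apply Rdiv_lt_0_compat; [apply pow_lt|]; lra.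
Qed.

Definition term (s : nat -> test) (f : T -> R) (j : nat) : R :=
  coef j * test_value (par_k j) (s j) f.

Definition tests_ok (s : nat -> test) : Prop := forall j, test_ok (par_c j) (par_n j) (s j).

Definition partial (m : nat) (s : nat -> test) (f : T -> R) : R := sumR (term s f) (seq 0 m).

(** Suprema and sums commute here: the lub of all partial sums over all choices of tests is
    the weighted sum of the suprema over the tests of each fixed triple [c], [k], [n]. *)
Definition kadec_norm (f : T -> R) : R :=
  epsilon (inhabits 0) (is_lub (fun y => exists m s, tests_ok s /\ y = partial m s f)).

Lemma term_nonneg s f j : 0 <= term s f j.
Proof. apply Rmult_le_pos; [apply Rlt_le, coef_pos|apply test_value_nonneg]. Qed.

Lemma term_bound s f j M : tests_ok s -> 0 <= M ->
  (forall t, In t (test_support (s j)) -> Rabs (f t) <= M) -> term s f j <= M * (/ 2) ^ S j.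
Proof.
  intros ok M0 H. unfold term, coef. pose proof (test_bound_ge_1 (par_c j) (par_n j)).
  assert (h := test_value_bound F col (par_c j) (par_k j) (par_n j) (s j) f M (ok j) M0 H).
  assert (0 < (/ 2) ^ S j) by (apply pow_lt; lra). set (p := (/ 2) ^ S j) in *.
  set (D := test_bound (par_c j) (par_n j)) in *.
  apply Rle_trans with (p / D * (D * M)).
  - apply Rmult_le_compat_l; auto. apply Rlt_le, Rdiv_lt_0_compat; lra.
  - right. field. lra.
Qed.

Lemma partial_bound m s f M : tests_ok s -> 0 <= M ->
  (forall j t, (j < m)%nat -> In t (test_support (s j)) -> Rabs (f t) <= M) -> partial m s f <= M.
Proof.
  intros ok M0 H. apply Rle_trans with (sumR (fun j => M * (/ 2) ^ S j) (seq 0 m)).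
  - apply sumR_le. intros j i. apply in_seq in i. apply term_bound; auto.
    intros t it. apply (H j); auto. lia.
  - rewrite sumR_scal. rewrite <- (Rmult_1_r M) at 2.
    apply Rmult_le_compat_l; auto. apply sumR_half_pow.
Qed.

Lemma partial_add m s f g : partial m s (fadd f g) <= partial m s f + partial m s g.
Proof.
  unfold partial. rewrite <- sumR_plus. apply sumR_le. intros j _. unfold term.
  rewrite <- Rmult_plus_distr_l. apply Rmult_le_compat_l; [apply Rlt_le, coef_pos|].
  apply test_value_add.
Qed.

Lemma partial_scal m s a f : partial m s (fscal a f) = Rabs a * partial m s f.
Proof.
  unfold partial. rewrite <- sumR_scal. apply sumR_ext. intros j _. unfold term.
  rewrite test_value_scal. lra.
Qed.

Lemma partial_mono m m' s f : (m <= m')%nat -> partial m s f <= partial m' s f.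
Proof.
  intros l. unfold partial. replace m' with (m + (m' - m))%nat by lia.
  rewrite seq_app, sumR_app.
  assert (0 <= sumR (term s f) (seq (0 + m) (m' - m))); [|lra].
  apply sumR_nonneg. intros; apply term_nonneg.
Qed.

Definition trivial_tests (j : nat) : test := ([], [], None).

Lemma trivial_tests_ok : tests_ok trivial_tests.
Proof.
  intros j. simpl. split; [apply admissible_nil|]. split; [tauto|].
  split; [lia|]. split; [lia|auto].
Qed.

Definition update (s : nat -> test) (j : nat) (i : test) : nat -> test :=
  fun j' => if Nat.eq_dec j' j then i else s j'.

Lemma update_eq s j i : update s j i j = i.
Proof. unfold update. destruct (Nat.eq_dec j j); congruence. Qed.

Lemma update_neq s j i j' : j' <> j -> update s j i j' = s j'.
Proof. unfold update. destruct (Nat.eq_dec j' j); congruence. Qed.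

Lemma update_ok s j i : tests_ok s -> test_ok (par_c j) (par_n j) i -> tests_ok (update s j i).
Proof. intros ok oki j'. unfold update. destruct (Nat.eq_dec j' j) as [->|]; auto. Qed.

Lemma kadec_norm_lub f M : (forall t, Rabs (f t) <= M) ->
  is_lub (fun y => exists m s, tests_ok s /\ y = partial m s f) (kadec_norm f).
Proof.
  intros H. unfold kadec_norm. apply epsilon_spec.
  destruct (completeness (fun y => exists m s, tests_ok s /\ y = partial m s f)) as (m & Hm).
  - exists (Rmax M 0). intros y (m & s & ok & ->). apply partial_bound; auto; [apply Rmax_r|].
    intros. eapply Rle_trans; [apply H|apply Rmax_l].
  - exists (partial 0 trivial_tests f), 0%nat, trivial_tests. split; auto using trivial_tests_ok.
  - exists m; auto.
Qed.

Lemma partial_le_norm f M m s : (forall t, Rabs (f t) <= M) -> tests_ok s ->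
  partial m s f <= kadec_norm f.
Proof. intros H ok. apply (kadec_norm_lub f M H). eauto. Qed.

Lemma norm_le_of_partial f M b : (forall t, Rabs (f t) <= M) ->
  (forall m s, tests_ok s -> partial m s f <= b) -> kadec_norm f <= b.
Proof. intros H Hb. apply (kadec_norm_lub f M H). intros y (m & s & ok & ->). auto. Qed.

Lemma norm_nonneg f M : (forall t, Rabs (f t) <= M) -> 0 <= kadec_norm f.
Proof. intros H. apply (partial_le_norm f M 0 trivial_tests H trivial_tests_ok). Qed.

Lemma norm_le_bound f M : 0 <= M -> (forall t, Rabs (f t) <= M) -> kadec_norm f <= M.
Proof.
  intros M0 H. apply (norm_le_of_partial f M); auto. intros m s ok. apply partial_bound; auto.
Qed.

Lemma norm_lower : exists b, 0 < b /\
  forall f M t, (forall t, Rabs (f t) <= M) -> b * Rabs (f t) <= kadec_norm f.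
Proof.
  (* Size 1 is enough: the test with [B = [t]] alone has the value [Rabs (f t)]. *)
  destruct (par_exists 0 0 1) as (j & jc & jk & jn). exists (coef j). split; [apply coef_pos|].
  intros f M t H. set (i := ([], [t], None) : test).
  assert (ok : tests_ok (update trivial_tests j i)).
  { apply update_ok; [apply trivial_tests_ok|]. rewrite jc, jn. simpl.
    split; [|split; [tauto|split; [lia|split; [lia|auto]]]].
    split; [apply NoDup_nil|]. split; [constructor; auto using NoDup_nil|].
    split; [intros x y [<-|[]] [<-|[]]; auto|intros x y _ []]. }
  eapply Rle_trans; [|apply (partial_le_norm f M (S j) _ H ok)].
  apply Rle_trans with (term (update trivial_tests j i) f j).
  - unfold term. rewrite update_eq. simpl. unfold weight_of. simpl. right. ring.
  - apply sumR_In; [intros; apply term_nonneg|]. apply in_seq. lia.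
Qed.

Lemma norm_scal a f M : (forall t, Rabs (f t) <= M) -> kadec_norm (fscal a f) = Rabs a * kadec_norm f.
Proof.
  intros H.
  assert (H' : forall t, Rabs (fscal a f t) <= Rabs a * M).
  { intros t. unfold fscal. rewrite Rabs_mult. apply Rmult_le_compat_l; auto. apply Rabs_pos. }
  apply Rle_antisym.
  - apply (norm_le_of_partial _ _ _ H'). intros m s ok. rewrite partial_scal.
    apply Rmult_le_compat_l; [apply Rabs_pos|]. apply (partial_le_norm f M); auto.
  - destruct (Req_dec a 0) as [->|na].
    + rewrite Rabs_R0, Rmult_0_l. apply (norm_nonneg _ _ H').
    + assert (a0 : 0 < Rabs a) by (apply Rabs_pos_lt; auto).
      apply (Rmult_le_reg_l (/ Rabs a)); [apply Rinv_0_lt_compat; auto|].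
      rewrite <- Rmult_assoc, Rinv_l, Rmult_1_l; [|lra].
      apply (norm_le_of_partial f M); auto. intros m s ok.
      apply (Rmult_le_reg_l (Rabs a)); auto.
      rewrite <- Rmult_assoc, Rinv_r, Rmult_1_l; [|lra].
      rewrite <- partial_scal. apply (partial_le_norm _ _ m s H' ok).
Qed.

Lemma norm_add f g M M' : (forall t, Rabs (f t) <= M) -> (forall t, Rabs (g t) <= M') ->
  kadec_norm (fadd f g) <= kadec_norm f + kadec_norm g.
Proof.
  intros H H'. apply (norm_le_of_partial _ (M + M')).
  - intros t. unfold fadd. specialize (H t). specialize (H' t).
    pose proof (Rabs_triang (f t) (g t)). lra.
  - intros m s ok. eapply Rle_trans; [apply partial_add|].
    apply Rplus_le_compat; eapply partial_le_norm; eauto.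
Qed.

Lemma kadec_norm_equivalent : equivalent_norm_C0 le kadec_norm.
Proof.
  destruct norm_lower as (b & b0 & Hb). split; [split; [|split; [|split]]|].
  - intros f Hf. destruct (C0_bounded Htree Hhaus f Hf) as (M & HM). apply (norm_nonneg f M HM).
  - intros f Hf Nf t. destruct (C0_bounded Htree Hhaus f Hf) as (M & HM).
    specialize (Hb f M t HM). rewrite Nf in Hb.
    apply NNPP. intros n. assert (0 < Rabs (f t)) by (apply Rabs_pos_lt; auto).
    assert (0 < b * Rabs (f t)) by (apply Rmult_lt_0_compat; auto). lra.
  - intros a f Hf. destruct (C0_bounded Htree Hhaus f Hf) as (M & HM). apply (norm_scal a f M HM).
  - intros f g Hf Hg. destruct (C0_bounded Htree Hhaus f Hf) as (M & HM).
    destruct (C0_bounded Htree Hhaus g Hg) as (M' & HM'). apply (norm_add f g M M' HM HM').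
  - exists b, 1. split; [auto|]. split; [lra|]. intros f m Hf (ub & lub).
    assert (m0 : 0 <= m) by (apply ub; auto).
    assert (Hm : forall t, Rabs (f t) <= m) by (intros t; apply ub; eauto).
    split; [|rewrite Rmult_1_l; apply norm_le_bound; auto].
    assert (m <= kadec_norm f / b).
    { apply lub. intros y [->|(t & ->)].
      - apply Rle_mult_inv_pos; auto. apply (norm_nonneg f m Hm).
      - apply (Rmult_le_reg_l b); auto. replace (b * (kadec_norm f / b)) with (kadec_norm f) by (field; lra).
        apply (Hb f m t Hm). }
    replace (kadec_norm f) with (b * (kadec_norm f / b)) by (field; lra).
    apply Rmult_le_compat_l; lra.
Qed.

(** On the unit sphere, pointwise closeness on a suitable finite set makes every supremum of tests for [g]
    nearly as small as the one for [f], because none of them can drop by much. *)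
Lemma kadec_norm_pointwise f r : inC0 le f -> kadec_norm f = 1 -> 0 < r ->
  exists W d, 0 < d /\ forall g, inC0 le g -> kadec_norm g = 1 ->
    (forall w, In w W -> Rabs (g w - f w) < d) -> kadec_norm (fsub g f) < r.
Proof.
  intros Hf N1 r0.
  destruct (tests_separate Htree Hhaus F col HF f (r / 2) Hf) as (c & k & n & delta & W & d0 & HW); [lra|].
  destruct (par_exists c k n) as (j & jc & jk & jn).
  destruct (C0_bounded Htree Hhaus f Hf) as (M & HM).
  pose proof (coef_pos j) as cj.
  (* Replacing one test lifts the partial sum of [g] from above [1 - 2 * eta] to at most 1, and
     passing from [g] to [f] in the old test costs another [eta]; together less than
     [coef j * delta]. *)
  set (eta := coef j * delta / 4).
  assert (eta0 : 0 < eta) by (unfold eta; pose proof (Rmult_lt_0_compat _ _ cj d0); lra).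
  assert (near : exists m s, tests_ok s /\ 1 - eta < partial m s f).
  { apply NNPP. intros no. assert (kadec_norm f <= 1 - eta); [|lra].
    apply (norm_le_of_partial f M); auto. intros m s ok. apply Rnot_lt_le. intros h. eauto. }
  destruct near as (m0 & s & ok & big0). set (m := max m0 (S j)).
  assert (big : 1 - eta < partial m s f).
  { eapply Rlt_le_trans; [apply big0|]. apply partial_mono. unfold m. lia. }
  assert (d1 : 0 < Rmin delta eta) by (apply Rmin_glb_lt; auto).
  exists (W ++ flat_map (fun j => test_support (s j)) (seq 0 m)), (Rmin delta eta).
  split; auto. intros g Hg Ng close.
  assert (ld : Rmin delta eta <= delta) by apply Rmin_l.
  assert (le' : Rmin delta eta <= eta) by apply Rmin_r.
  set (d := Rmin delta eta) in *. clearbody d.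
  destruct (C0_bounded Htree Hhaus g Hg) as (M' & HM').
  assert (supp : forall i t, (i < m)%nat -> In t (test_support (s i)) -> Rabs (g t - f t) <= d).
  { intros i t im it. apply Rlt_le, close. apply in_or_app. right. apply in_flat_map.
    exists i. split; auto. apply in_seq. lia. }
  assert (pg : 1 - 2 * eta < partial m s g).
  { assert (E : f = fadd g (fsub f g)).
    { apply functional_extensionality. intros t. unfold fadd, fsub. lra. }
    assert (h := partial_add m s g (fsub f g)). rewrite <- E in h.
    assert (h' : partial m s (fsub f g) <= d); [|lra].
    apply partial_bound; auto; [lra|]. intros i t im it. unfold fsub.
    rewrite Rabs_minus_sym. apply (supp i); auto. }
  assert (jm : (j < m)%nat) by (unfold m; lia).
  assert (final : forall t, Rabs (g t - f t) <= r / 2).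
  { apply HW.
    - intros w iw. apply Rlt_le_trans with d; auto. apply close. apply in_or_app; auto.
    - intros i' ok'. exists (s j). split; [rewrite <- jc, <- jn; apply ok|].
      rewrite <- jc, <- jn in ok'.
      assert (h := partial_le_norm g M' m _ HM' (update_ok s j i' ok ok')). rewrite Ng in h.
      unfold partial in h. rewrite (sumR_update (term s g) _ _ j) in h.
      + fold (partial m s g) in h. unfold term in h. rewrite update_eq, jk in h.
        assert (E : g = fadd f (fsub g f)).
        { apply functional_extensionality. intros t. unfold fadd, fsub. lra. }
        assert (h1 := test_value_add F k (s j) f (fsub g f)). rewrite <- E in h1.
        assert (h2 : term s (fsub g f) j <= d * (/ 2) ^ S j).
        { apply term_bound; auto; [lra|]. intros t it. apply (supp j); auto. }
        unfold term in h2. rewrite jk in h2.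
        assert (h3 : (/ 2) ^ S j <= 1).
        { rewrite <- (pow1 (S j)). apply pow_incr. lra. }
        assert (h4 : d * (/ 2) ^ S j <= eta).
        { apply Rle_trans with (d * 1); [apply Rmult_le_compat_l; lra|lra]. }
        assert (h5 : coef j * test_value k (s j) g <=
           coef j * (test_value k (s j) f + test_value k (s j) (fsub g f))).
        { apply Rmult_le_compat_l; lra. }
        apply (Rmult_le_reg_l (coef j)); auto. unfold eta in *. lra.
      + apply seq_NoDup.
      + apply in_seq. lia.
      + intros i ni. unfold term. rewrite update_neq; auto. }
  assert (kadec_norm (fsub g f) <= r / 2); [|lra]. apply norm_le_bound; [lra|exact final].
Qed.

End Norm.

(** * From finitely many evaluations to the weak topology *)

Section Kadec.
Context {T : Type} {le : T -> T -> Prop} (Htree : is_tree le) (Hhaus : hausdorff_tree le).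

Lemma dual_eval N t : equivalent_norm_C0 le N -> dual_elem le N (fun f => f t).
Proof.
  intros HN. destruct (equivalent_norm_bounds Htree Hhaus N HN) as (c & C & c0 & _ & lower & _).
  split; [reflexivity|]. split; [reflexivity|]. exists (/ c). intros f Hf.
  apply (Rmult_le_reg_l c); auto. rewrite <- Rmult_assoc, Rinv_r, Rmult_1_l; [auto|lra].
Qed.

Lemma weak_open_norm_open N U : equivalent_norm_C0 le N -> weak_open le N U -> norm_open le N U.
Proof.
  intros HN Uop f Hf Uf. destruct (Uop f Hf Uf) as (l & d & dual & d0 & H).
  destruct (uniform_pos (fun phi r => forall g, inC0 le g -> N (fsub g f) < r ->
     Rabs (phi g - phi f) < d) l) as (r & r0 & Hr).
  - intros phi r r' rr h g Hg Ng. apply h; auto. lra.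
  - intros phi i. assert (dphi := dual phi i). assert (dphi' := dphi).
    destruct dphi' as (_ & _ & K & HK). pose proof (Rabs_pos K) as K0.
    exists (d / (Rabs K + 1)). split; [apply Rdiv_lt_0_compat; lra|].
    intros g Hg Ng. rewrite <- (dual_sub Htree Hhaus N phi g f); auto.
    assert (Hc := C0_sub Htree Hhaus g f Hg Hf).
    assert (pos : 0 <= N (fsub g f)) by (apply HN; auto).
    eapply Rle_lt_trans; [apply HK; auto|].
    apply Rle_lt_trans with ((Rabs K + 1) * N (fsub g f)).
    + apply Rmult_le_compat_r; auto. pose proof (Rle_abs K). lra.
    + replace d with ((Rabs K + 1) * (d / (Rabs K + 1))) by (field; lra).
      apply Rmult_lt_compat_l; lra.
  - exists r. split; auto.
Qed.

(** Evaluations are bounded functionals, so conditions at finitely many points define weakly open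
    sets. The passage from weakly open to norm open sets holds for every equivalent norm. *)
Lemma kadec_of_pointwise N : equivalent_norm_C0 le N ->
  (forall f r, inC0 le f -> N f = 1 -> 0 < r -> exists W d, 0 < d /\
     forall g, inC0 le g -> N g = 1 -> (forall w, In w W -> Rabs (g w - f w) < d) -> N (fsub g f) < r) ->
  kadec le N.
Proof.
  intros HN point A. split; intros (U & Uop & HU).
  { exists U. split; auto. apply weak_open_norm_open; auto. }
  (* The union of all pointwise neighbourhoods, centred on the sphere in [U], whose trace on the
     sphere stays in [U]; taking all of them avoids choosing [W] and [d] for each centre. *)
  exists (fun h => exists f W d, inC0 le f /\ N f = 1 /\ U f /\ 0 < d /\
    (forall g, inC0 le g -> N g = 1 -> (forall w, In w W -> Rabs (g w - f w) < d) -> U g) /\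
    forall w, In w W -> Rabs (h w - f w) < d).
  split.
  - intros h Hh (f & W & d & Hf & Nf & Uf & d0 & HW & close).
    destruct (uniform_pos (fun w r => Rabs (h w - f w) + r <= d) W) as (r & r0 & Hr).
    { intros; lra. }
    { intros w i. exists (d - Rabs (h w - f w)). specialize (close w i). lra. }
    exists (map (fun w (f : T -> R) => f w) W), r. split; [|split; auto].
    + intros phi i. apply in_map_iff in i. destruct i as (w & <- & _). apply dual_eval; auto.
    + intros g Hg near. exists f, W, d. repeat (split; [assumption|]). intros w i.
      specialize (near (fun f => f w) (in_map (fun w (f : T -> R) => f w) W w i)). simpl in near.
      specialize (Hr w i). replace (g w - f w) with ((g w - h w) + (h w - f w)) by lra.
      eapply Rle_lt_trans; [apply Rabs_triang|]. lra.
  - intros f Hf Nf. rewrite (HU f Hf Nf). split.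
    + intros Uf. destruct (Uop f Hf Uf) as (r & r0 & Hr).
      destruct (point f r Hf Nf r0) as (W & d & d0 & HW).
      exists f, W, d. repeat (split; [assumption|]). split.
      * intros g Hg Ng close. apply Hr; auto.
      * intros w _. rewrite Rminus_diag, Rabs_R0. auto.
    + intros (f' & W & d & _ & _ & _ & _ & HW & close). apply HW; auto.
Qed.

End Kadec.

Theorem theorem6p1 (T : Type) (le : T -> T -> Prop)
  (Htree : is_tree le) (Hhaus : hausdorff_tree le) :
  (exists N : (T -> R) -> R, equivalent_norm_C0 le N /\ kadec le N) <->
  (exists rho : T -> R, tree_increasing le rho /\ forall t, ~ bad_point le rho t).
Proof.
  split.
  - intros (N & HN & HK). apply (increasing_of_kadec Htree Hhaus N HN HK).
  - intros (rho & inc & good).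
    destruct (branching_exists rho inc good) as (F & col & HF).
    assert (HN := kadec_norm_equivalent Htree Hhaus F col).
    exists (kadec_norm (le := le) F col). split; auto.
    apply (kadec_of_pointwise Htree Hhaus); auto.
    apply (kadec_norm_pointwise Htree Hhaus F col HF).
Qed.
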